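(* Let $G$ be a totally disconnected, locally compact group with $\mathrm{QZ}(G)=\{1\}$, such that $G$ has a hereditarily just infinite compact open subgroup and $G$ is compactly generated. Suppose that $R = \mathrm{Res}(G)$ is open but $\mathrm{Res}(R)$ is trivial. Then the following holds. (i) There is a noncompact open normal subgroup $K$ of $R$ such that, given any nontrivial closed normal subgroup $Q$ of $R$, then $Q$ contains a $G$-conjugate of $K$. (ii) There is a $G$-conjugate of $K$ that properly contains $K$. (iii) Given a compactly generated subgroup $H$ of $G$ such that $R \le H$, then $\mathrm{Res}_R(H)$ is open in $R$. In particular, $R$ is not compactly generated. (iv) Let $L$ be a subgroup of $G$ containing $R$ such that $L/R$ is virtually polycyclic. Then every open normal subgroup of $R$ contains an open normal subgroup of $L$; in particular, $L$ is residually discrete.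
   Context: All groups are locally compact Hausdorff topological groups. The quasi-centre $\mathrm{QZ}(G)$ is the set of elements of $G$ with open centralizer. $\mathrm{Res}(G)$ is the intersection of all open normal subgroups of $G$; $G$ is residually discrete if $\mathrm{Res}(G)=\{1\}$. For a group $H$ acting on $R$ (here by conjugation), $\mathrm{Res}_R(H)$ is the intersection of all open $H$-invariant subgroups of $R$. A profinite group is just infinite if it is infinite and every nontrivial closed normal subgroup has finite index; it is hereditarily just infinite if every open subgroup is just infinite. *)

(* Defs.v *)
From HB Require Import structures.
From mathcomp Require Import all_boot all_classical.
From mathcomp Require Import topology_structure product_topology compact connected.
From mathcomp Require Import subspace_topology subtype_topology separation_axioms.

Set Implicit Arguments.
Unset Strict Implicit.
Unset Printing Implicit Defensive.

Local Open Scope classical_set_scope.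
Local Open Scope group_scope.

HB.mixin Record Group_isTopologicalGroup G of Group G & Topological G := {
  mulg_continuous : continuous (fun x : G * G => x.1 * x.2);
  invg_continuous : continuous (fun x : G => x^-1)
}.

#[short(type="topGroupType")]
HB.structure Definition TopologicalGroup :=
  {G of Group G & Topological G & Group_isTopologicalGroup G}.

Section AbstractGroups.
Variable G : groupType.
Implicit Types (N H X : set G).

Definition is_subgroup H := H 1 /\ forall x y, H x -> H y -> H (x / y).

Definition generated X : set G := smallest is_subgroup X.

(* Here x ^ h is MathComp's conjugate h^-1 * x * h. *)
Definition conj_set H (g : G) : set G := (fun x => x ^ g) @` H.

Definition is_normal N H :=
  [/\ is_subgroup H, is_subgroup N, N `<=` H &
      forall h x, H h -> N x -> N (x ^ h)].

Definition lcosets N H : set (set G) := [set (mul x) @` N | x in H].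

Definition finite_index N H := finite_set (lcosets N H).

Lemma is_subgroupV H x : is_subgroup H -> H x -> H x^-1.
Proof. by move=> [H1 HF] Hx; rewrite -div1g; apply: HF. Qed.

Lemma is_subgroupM H x y : is_subgroup H -> H x -> H y -> H (x * y).
Proof.
by move=> sH Hx Hy; rewrite -[y]invgK; apply: sH.2 => //; apply: is_subgroupV.
Qed.

End AbstractGroups.

(* The quotient group H / N, whose elements are the cosets x N, multiplied and
   inverted as subsets of G. *)
Definition quotient (G : groupType) (N H : set G) (nNH : is_normal N H) : Type :=
  set_type (lcosets N H).

Section Quotient.
Variables (G : groupType) (N H : set G) (nNH : is_normal N H).
Local Notation quotient := (quotient nNH).

HB.instance Definition _ := Choice.copy quotient (set_type (lcosets N H)).

Let normalV (h x : G) : H h -> N x -> N (h * x / h).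
Proof.
case: nNH => sH _ _ cN Hh Nx.
by have := cN _ _ (is_subgroupV sH Hh) Nx; rewrite conjgE invgK mulgA.
Qed.

Let lcoset_mul (x y : G) : H x -> H y ->
  [set c * d | c in (mul x) @` N & d in (mul y) @` N] = (mul (x * y)) @` N.
Proof.
case: (nNH) => sH sN NH cN Hx Hy; apply/seteqP; split=> z.
  move=> [_ [n Nn <-]] [_ [m Nm <-]] <-; exists (n ^ y * m).
    by apply: is_subgroupM => //; apply: cN.
  by rewrite conjgE !mulgA mulgK.
move=> [n Nn <-]; exists x; first by exists 1; [case: sN|rewrite mulg1].
by exists (y * n); [exists n|rewrite mulgA].
Qed.

Let lcoset_inv (x : G) : H x -> (fun c => c^-1) @` ((mul x) @` N) = (mul x^-1) @` N.
Proof.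
case: (nNH) => sH sN NH cN Hx; apply/seteqP; split=> z.
  move=> [_ [n Nn <-] <-]; exists (x * n^-1 / x).
    by apply: normalV => //; apply: is_subgroupV.
  by rewrite invgM !mulgA mulVg mul1g.
move=> [n Nn <-]; exists (n^-1 * x); last by rewrite invgM invgK.
exists (n^-1 ^ x); first by apply: cN => //; apply: is_subgroupV.
by rewrite conjgE !mulgA mulgV mul1g.
Qed.

Let one_subproof : N \in lcosets N H.
Proof.
case: (nNH) => sH _ _ _; apply/mem_set; exists 1; first by case: sH.
by rewrite -[RHS]image_id; apply: eq_imagel => x _; rewrite mul1g.
Qed.

Let quotientP (C : quotient) : exists2 x, H x & set_val C = (mul x) @` N.
Proof. by have /set_mem[x Hx CE] := valP C; exists x => //; rewrite -CE. Qed.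

Let mul_subproof (C D : quotient) :
  [set c * d | c in set_val C & d in set_val D] \in lcosets N H.
Proof.
have [[x Hx ->] [y Hy ->]] := (quotientP C, quotientP D).
apply/mem_set; rewrite lcoset_mul //; exists (x * y) => //.
by case: nNH => sH *; apply: is_subgroupM.
Qed.

Let inv_subproof (C : quotient) : (fun c => c^-1) @` (set_val C) \in lcosets N H.
Proof.
have [x Hx ->] := quotientP C; apply/mem_set.
rewrite lcoset_inv //; exists x^-1 => //.
by case: nNH => sH *; apply: is_subgroupV.
Qed.

Local Notation coset := (exist (fun C => C \in lcosets N H)).
Definition quotient_one : quotient := coset N one_subproof.
Definition quotient_mul (C D : quotient) : quotient :=
  coset _ (mul_subproof C D).
Definition quotient_inv (C : quotient) : quotient := coset _ (inv_subproof C).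

Let H1 : H 1. Proof. by case: nNH => -[]. Qed.

Let NE : N = (mul 1) @` N.
Proof. by rewrite -[LHS]image_id; apply: eq_imagel => x _; rewrite mul1g. Qed.

Let HV x : H x -> H x^-1.
Proof. by case: nNH => sH *; apply: is_subgroupV. Qed.

Let HM x y : H x -> H y -> H (x * y).
Proof. by case: nNH => sH *; apply: is_subgroupM. Qed.

Let oneE : set_val quotient_one = (mul 1) @` N.
Proof. exact: NE. Qed.

Let mulE (C D : quotient) (x y : G) : H x -> H y ->
  set_val C = (mul x) @` N -> set_val D = (mul y) @` N ->
  set_val (quotient_mul C D) = (mul (x * y)) @` N.
Proof. by move=> Hx Hy Cx Dy; rewrite -lcoset_mul // -Cx -Dy. Qed.

Let invE (C : quotient) (x : G) : H x ->
  set_val C = (mul x) @` N -> set_val (quotient_inv C) = (mul x^-1) @` N.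
Proof. by move=> Hx Cx; rewrite -lcoset_inv // -Cx. Qed.

Let quotient_mulA : associative quotient_mul.
Proof.
move=> C D E; apply: val_inj.
have [[[x Hx Cx] [y Hy Dy]] [z Hz Ez]] :=
  (quotientP C, quotientP D, quotientP E).
have Dyz := mulE Hy Hz Dy Ez; have Cxy := mulE Hx Hy Cx Dy.
have := mulE Hx (HM Hy Hz) Cx Dyz; rewrite mulgA => e.
exact: etrans e (esym (mulE (HM Hx Hy) Hz Cxy Ez)).
Qed.

Let quotient_mul1g : left_id quotient_one quotient_mul.
Proof.
move=> C; apply: val_inj; have [x Hx Cx] := quotientP C.
by have := mulE H1 Hx oneE Cx; rewrite mul1g -Cx.
Qed.

Let quotient_mulg1 : right_id quotient_one quotient_mul.
Proof.
move=> C; apply: val_inj; have [x Hx Cx] := quotientP C.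
by have := mulE Hx H1 Cx oneE; rewrite mulg1 -Cx.
Qed.

Let quotient_mulVg : left_inverse quotient_one quotient_inv quotient_mul.
Proof.
move=> C; apply: val_inj; have [x Hx Cx] := quotientP C.
by have := mulE (HV Hx) Hx (invE Hx Cx) Cx; rewrite mulVg -oneE.
Qed.

Let quotient_mulgV : right_inverse quotient_one quotient_inv quotient_mul.
Proof.
move=> C; apply: val_inj; have [x Hx Cx] := quotientP C.
by have := mulE Hx (HV Hx) Cx (invE Hx Cx); rewrite mulgV -oneE.
Qed.

HB.instance Definition _ := isGroup.Build quotient
  quotient_mulA quotient_mul1g quotient_mulg1 quotient_mulVg quotient_mulgV.

End Quotient.

Section Polycyclic.
Implicit Type Q : groupType.

Definition cyclic Q := exists x : Q, [set: Q] = generated [set x].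

Definition polycyclic Q (P : set Q) :=
  exists (n : nat) (A : nat -> set Q), [/\ A 0 = [set 1], A n = P &
    forall i, (i < n)%N ->
      exists nA : is_normal (A i) (A i.+1), cyclic (quotient nA)].

Definition virtually_polycyclic Q :=
  exists P : set Q, [/\ is_subgroup P, finite_index P [set: Q] & polycyclic P].

End Polycyclic.

(* A subgroup H of G carries the subspace topology: a subset B of H is open
   (resp. closed) in H when it is so as a set of [subspace H]. *)
Section TopologicalGroups.
Variable G : topGroupType.
Implicit Types (N H K R : set G).

Definition open_normal K H := open (K : set (subspace H)) /\ is_normal K H.

Definition closed_normal K H := closed (K : set (subspace H)) /\ is_normal K H.

Definition QZ : set G := [set x | open [set y : G | commute x y]].

Definition Res H : set G := \bigcap_(N in [set N | open_normal N H]) N.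

Definition residually_discrete H := Res H = [set 1].

Definition Res_in R H : set G :=
  \bigcap_(V in [set V | [/\ open (V : set (subspace R)), is_subgroup V,
                            V `<=` R & forall h, H h -> conj_set V h = V]]) V.

Definition compactly_generated H :=
  exists2 X : set G, compact X & H = generated X.

Definition profinite H :=
  [/\ is_subgroup H, compact H, hausdorff_space (set_type H) &
      totally_disconnected H].

Definition just_infinite H :=
  [/\ profinite H, infinite_set H &
      forall N, closed_normal N H -> N <> [set 1] -> finite_index N H].

Definition hereditarily_just_infinite H :=
  profinite H /\
  forall K, is_subgroup K -> K `<=` H -> open (K : set (subspace H)) ->
    just_infinite K.

Lemma Res_normal (L : set G) :
  is_subgroup L -> Res [set: G] `<=` L -> is_normal (Res [set: G]) L.
Proof.
move=> sL RL; split=> //.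
- split=> [N [_ [_ [N1 _] _ _]] //|x y Rx Ry N oN].
  by case: (oN) => _ [_ [_ NF] _ _]; apply: NF; [exact: Rx|exact: Ry].
- move=> h x _ Rx N oN.
  by case: (oN) => _ [_ _ _ cN]; apply: cN => //; exact: Rx.
Qed.

End TopologicalGroups.

Arguments QZ : clear implicits.

(* Main.v *)
Require Import Defs.
From mathcomp Require Import all_boot all_classical.
From mathcomp Require Import topology_structure product_topology compact connected.
From mathcomp Require Import subspace_topology subtype_topology separation_axioms.

(* In G every nontrivial closed subgroup with open normalizer is open. Hence R has
   no compact open normal subgroup: otherwise a maximal open normal subgroup of R
   and its G-conjugates, which intersect trivially, would make R decompose locally
   as a product.

   Let U be a compact open subgroup of R. If a compactly generated H >= R is
   generated by U and X, let V be an open subgroup contained in every U ^ x, x in X.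
   Some H-conjugate of any open normal subgroup Q of R meets the compact set U \ V,
   for otherwise Q `&` U would be normal in R. This gives (iii) by compactness. For
   H = G, only finitely many minimal open normal subgroups meeting U \ V are
   needed to have one below each of them, and their intersection has a conjugate
   containing one of them: this is K.

   For (iv) it suffices that the conjugates of an open normal subgroup of R under
   the powers of t in G have nontrivial intersection. Otherwise t would, up to
   inversion, contract an open subgroup of G that has a compact open normal
   subgroup, and the argument for R applies to that subgroup. *)

Set Implicit Arguments.
Unset Strict Implicit.
Unset Printing Implicit Defensive.

Local Open Scope classical_set_scope.
Local Open Scope group_scope.

(** * Compactness arguments *)

Section Compactness.
Variables (T : topologicalType) (W : set T).
Hypothesis cW : compact W.

(** The traces on [W] of the members of [F] generate a proper filter; a cluster point of it lies in
    every closed member. *)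
Lemma compact_directed (F : set (set T)) :
  F !=set0 ->
  (forall A B, F A -> F B -> exists2 C, F C & C `<=` A `&` B) ->
  (forall A, F A -> closed A) -> (forall A, F A -> W `&` A !=set0) ->
  exists2 x, W x & forall A, F A -> A x.
Proof.
move=> [A0 FA0] Fdir Fcl Fne.
have FF : ProperFilter (filter_from F (fun A => W `&` A)).
  apply: filter_from_proper => //; apply: filter_from_filter; first by exists A0.
  move=> A B FA FB; have [C FC CAB] := Fdir A B FA FB.
  by exists C => // x [Wx /CAB[Ax Bx]].
have [|x [Wx xF]] := cW FF; first by exists A0 => // x [].
exists x => // A FA; apply: Fcl => // V xV.
have [|y [[_ Ay] Vy]] := xF (W `&` A) V _ xV; first by exists A.
by exists y.
Qed.

(** This replaces finite subcovers: if [P W] failed, the complements of the open sets satisfying [P]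
    would share a point of [W]. *)
Lemma compact_ind (P : set T -> Prop) :
  P set0 -> (forall A B, P A -> P B -> P (A `|` B)) ->
  (forall A B, A `<=` B -> P B -> P A) ->
  (forall x, W x -> exists O, [/\ open O, O x & P O]) -> P W.
Proof.
move=> P0 PU PS Ploc; apply: contrapT => nPW.
have [||_ [A [oA PA] <-]|_ [A [oA PA] <-]|x Wx xF] :=
    @compact_directed [set ~` A | A in [set A | open A /\ P A]].
- by exists (~` set0), set0 => //; split=> //; exact: open0.
- move=> _ _ [A [oA PA] <-] [B [oB PB] <-]; exists (~` (A `|` B)).
    by exists (A `|` B) => //; split; [exact: openU|exact: PU].
  by rewrite setCU.
- exact: open_closedC.
- apply: contrapT => /nonemptyPn WA; apply: nPW; apply: PS PA => x Wx.
  by apply: contrapT => nAx; have : (W `&` ~` A) x by []; rewrite WA.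
have [O [oO Ox PO]] := Ploc x Wx.
by apply: (xF (~` O)) => //; exists O.
Qed.

End Compactness.

(** * Conjugates of subsets and normal subgroups *)

Section ConjSet.
Variable G : groupType.
Implicit Types (N H A B X : set G) (g h x : G).

Lemma conj_setE N g x : conj_set N g x = N (x ^ g^-1).
Proof.
apply/propext; split=> [[y Ny <-]|Nx]; first by rewrite conjgK.
by exists (x ^ g^-1) => //; rewrite conjgKV.
Qed.

Lemma conj_set_preimage N g : conj_set N g = (fun x => x ^ g^-1) @^-1` N.
Proof. by apply/funext => x; rewrite conj_setE. Qed.

Lemma conj_setM N g h : conj_set (conj_set N g) h = conj_set N (g * h).
Proof. by apply/funext => x; rewrite !conj_setE invgM conjgM. Qed.

Lemma conj_set1 N : conj_set N 1 = N.
Proof. by apply/funext => x; rewrite conj_setE invg1 conjg1. Qed.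

Lemma conj_setK N g : conj_set (conj_set N g) g^-1 = N.
Proof. by rewrite conj_setM mulgV conj_set1. Qed.

Lemma conj_setKV N g : conj_set (conj_set N g^-1) g = N.
Proof. by rewrite conj_setM mulVg conj_set1. Qed.

Lemma conj_setI A B g : conj_set (A `&` B) g = conj_set A g `&` conj_set B g.
Proof. by rewrite !conj_set_preimage. Qed.

Lemma conj_setS A B g : A `<=` B -> conj_set A g `<=` conj_set B g.
Proof. by move=> AB x; rewrite !conj_setE; apply: AB. Qed.

Lemma conj_setSV A B g : A `<=` conj_set B g^-1 -> conj_set A g `<=` B.
Proof. by move=> /(conj_setS (g := g)); rewrite conj_setKV. Qed.

Lemma is_subgroup_conj N g : is_subgroup N -> is_subgroup (conj_set N g).
Proof.
move=> [N1 NF]; split=> [|x y]; rewrite !conj_setE ?conj1g //.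
by rewrite conjMg conjVg; apply: NF.
Qed.

Lemma is_subgroupX H x n : is_subgroup H -> H x -> H (x ^+ n).
Proof.
by move=> sH Hx; elim: n => [|n IH]; [case: sH|rewrite expgS; exact: (is_subgroupM sH)].
Qed.

Lemma is_subgroupI A B : is_subgroup A -> is_subgroup B -> is_subgroup (A `&` B).
Proof.
by move=> [A1 AF] [B1 BF]; split=> // x y [Ax Bx] [Ay By]; split;
  [apply: AF|apply: BF].
Qed.

Lemma is_subgroup_bigcap (I : Type) (D : set I) (F : I -> set G) :
  (forall i, D i -> is_subgroup (F i)) -> is_subgroup (\bigcap_(i in D) F i).
Proof.
move=> sF; split=> [i /sF[]//|x y Fx Fy i Di].
by have [_] := sF i Di; apply; [exact: Fx|exact: Fy].
Qed.

Lemma is_subgroup_conj_id H h : is_subgroup H -> H h -> conj_set H h = H.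
Proof.
move=> sH Hh; apply/seteqP; split=> x; rewrite conj_setE => Hx; last first.
  have HhV := is_subgroupV sH Hh; rewrite conjgE invgK.
  by apply: (is_subgroupM sH) => //; apply: (is_subgroupM sH).
rewrite -[x](conjgKV h) conjgE; apply: (is_subgroupM sH).
  exact: (is_subgroupV sH).
exact: (is_subgroupM sH).
Qed.

Lemma is_normalE N H :
  is_normal N H <-> [/\ is_subgroup H, is_subgroup N, N `<=` H &
                       forall h, H h -> conj_set N h = N].
Proof.
split=> [[sH sN NH cN]|[sH sN NH cN]]; split=> //.
  move=> h Hh; apply/seteqP; split=> x; rewrite conj_setE => Nx.
    by rewrite -[x](conjgKV h); apply: cN.
  by apply: cN => //; apply: (is_subgroupV sH).
by move=> h x Hh Nx; rewrite -(cN h Hh); exists x.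
Qed.

Lemma is_normal_sub N H g : is_normal N H -> H g -> conj_set N g = N.
Proof. by move=> /is_normalE[_ _ _]; apply. Qed.

Lemma is_normal_refl H : is_subgroup H -> is_normal H H.
Proof. by move=> sH; apply/is_normalE; split=> // h; apply: is_subgroup_conj_id. Qed.

Lemma is_normalI A B H : is_normal A H -> is_normal B H -> is_normal (A `&` B) H.
Proof.
move=> /is_normalE[sH sA AH cA] /is_normalE[_ sB BH cB]; apply/is_normalE.
split=> //; [exact: is_subgroupI|by move=> x []; auto|].
by move=> h Hh; rewrite conj_setI cA // cB.
Qed.

Lemma is_normal_conj N H g :
  is_normal N H -> conj_set H g = H -> is_normal (conj_set N g) H.
Proof.
move=> /is_normalE[sH sN NH cN] Hg; apply/is_normalE; split=> //.
- exact: is_subgroup_conj.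
- by rewrite -Hg; apply: conj_setS.
- move=> h Hh; have Hh' : H (h ^ g^-1) by rewrite -conj_setE Hg.
  by rewrite -[in RHS](cN _ Hh') !conj_setM conjgE invgK !mulgA mulgVK.
Qed.

Lemma is_normal_bigcap (I : Type) (D : set I) (F : I -> set G) H :
  is_subgroup H -> D !=set0 -> (forall i, D i -> is_normal (F i) H) ->
  is_normal (\bigcap_(i in D) F i) H.
Proof.
move=> sH [i0 Di0] nF; split=> //.
- by apply: is_subgroup_bigcap => i /nF[].
- by move=> x /(_ i0 Di0); case: (nF i0 Di0) => _ _ + _; apply.
- by move=> h x Hh Fx i Di; case: (nF i Di) => _ _ _ cF; apply: cF => //; apply: Fx.
Qed.

(** The set is the preimage in [H] of the centralizer of the image of [X] in H / A. *)
Lemma is_normal_centralizer_mod A X H :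
  is_normal A H -> X `<=` H -> (forall h, H h -> conj_set X h `<=` X) ->
  is_normal [set h | H h /\ forall x, X x -> A [~ x, h]] H.
Proof.
move=> [sH sA AH cA] XH cX; split=> //.
- split=> [|e f [He Ae] [Hf Af]].
    by split; [case: sH|move=> x _; rewrite commg1; case: sA].
  split=> [|x Xx]; first exact: sH.2.
  have HfV := is_subgroupV sH Hf.
  have -> : [~ x, e / f] = ([~ x, f] ^ f^-1)^-1 * [~ x, e] ^ f^-1.
    rewrite !commgEl (conjMg x^-1 (x ^ f)) (conjMg x^-1 (x ^ e)).
    by rewrite !conjVg conjgK conjgM invgM invgK -mulgA mulVKg.
  by apply: (is_subgroupM sA); [apply: (is_subgroupV sA)|];
    apply: cA => //; [exact: Af|exact: Ae].
- by move=> x [].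
- move=> h e Hh [He Ae]; have HhV := is_subgroupV sH Hh; split.
    by rewrite -(is_subgroup_conj_id sH Hh); exists e.
  move=> x Xx; rewrite -[x](conjgKV h) -conjRg; apply: cA => //; apply: Ae.
  by apply: (cX _ HhV); exists x.
Qed.

Lemma sub_centralizer_mod A X H :
  is_normal A H -> X `<=` H ->
  A `<=` [set h | H h /\ forall x, X x -> A [~ x, h]].
Proof.
move=> [sH sA AH cA] XH a Aa; split; [exact: AH|move=> x /XH Hx].
rewrite commgEr; apply: (is_subgroupM sA) => //; apply: cA => //.
exact: (is_subgroupV sA).
Qed.

Lemma normalizer_is_subgroup N : is_subgroup [set g | conj_set N g = N].
Proof.
split=> [|x y /= Nx Ny]; first exact: conj_set1.
by rewrite -conj_setM Nx -{1}Ny conj_setK.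
Qed.

End ConjSet.

(** * Open subgroups of topological groups and the quasi-centre *)

Section TopologicalGroup.
Variable G : topGroupType.
Implicit Types (N H E U V : set G) (g h x : G).

Lemma continuous_mulgl g : continuous (fun x : G => g * x).
Proof.
move=> x; apply: (@continuous_comp _ _ _ (fun x => (g, x)) (fun p : G * G => p.1 * p.2)).
  by apply: cvg_pair => //=; exact: cvg_cst.
exact: mulg_continuous.
Qed.

Lemma continuous_mulgr g : continuous (fun x : G => x * g).
Proof.
move=> x; apply: (@continuous_comp _ _ _ (fun x => (x, g)) (fun p : G * G => p.1 * p.2)).
  by apply: cvg_pair => //=; exact: cvg_cst.
exact: mulg_continuous.
Qed.

Lemma continuous_conjg g : continuous (fun x : G => x ^ g).
Proof.
move=> x; apply: (@continuous_comp _ _ _ (fun x => x * g) (fun x => g^-1 * x)).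
  exact: continuous_mulgr.
exact: continuous_mulgl.
Qed.

Lemma continuous_conjg_fun x : continuous (fun g : G => x ^ g).
Proof.
move=> g.
apply: (@continuous_comp _ _ _ (fun g : G => (g^-1, x * g)) (fun p : G * G => p.1 * p.2)).
  by apply: cvg_pair; [exact: invg_continuous|exact: continuous_mulgl].
exact: mulg_continuous.
Qed.

Lemma open_preimage (f : G -> G) V : continuous f -> open V -> open (f @^-1` V).
Proof. by move=> /continuousP; apply. Qed.

Lemma open_conj N g : open N -> open (conj_set N g).
Proof.
move=> oN; rewrite conj_set_preimage; apply: open_preimage => //.
exact: continuous_conjg.
Qed.

Lemma subgroup_open N V : is_subgroup N -> open V -> V 1 -> V `<=` N -> open N.
Proof.
move=> sN oV V1 VN; rewrite openE => x Nx; rewrite /interior nbhsE.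
exists ((fun y => x^-1 * y) @^-1` V).
  split; first by apply: open_preimage => //; exact: continuous_mulgl.
  by rewrite /= mulVg.
move=> y /= /VN Nxy; rewrite -[y](mulVKg x); exact: (is_subgroupM sN).
Qed.

Lemma open_subgroup_closed N : is_subgroup N -> open N -> closed N.
Proof.
move=> sN oN; rewrite -openC openE => x /= nNx; rewrite /interior nbhsE.
exists ((fun y => x^-1 * y) @^-1` N).
  split; first by apply: open_preimage => //; exact: continuous_mulgl.
  by rewrite /= mulVg; case: sN.
move=> y /= Nxy Ny; apply: nNx.
by have := is_subgroupM sN Ny (is_subgroupV sN Nxy); rewrite invgM invgK mulVKg.
Qed.

End TopologicalGroup.

Lemma open_normalE (G : topGroupType) (K H : set G) :
  open H -> open_normal K H <-> open K /\ is_normal K H.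
Proof.
move=> oH; split=> [[oK nK]|[oK nK]]; split=> //; last exact: open_subspaceW.
have [_ _ KH _] := nK.
by have := open_setIS (K : set (subspace H)) oH; rewrite setIidl // => ->.
Qed.

Lemma closed_normalE (G : topGroupType) (K H : set G) :
  closed H -> closed_normal K H <-> closed K /\ is_normal K H.
Proof.
move=> cH; split=> [[cK nK]|[cK nK]]; split=> //; last exact: closed_subspaceW.
have [_ _ KH _] := nK.
by have := closed_setIS (K : set (subspace H)) cH; rewrite setIidl // => ->.
Qed.

(** The centralizer of [x] is a subgroup, hence open once it contains a neighbourhood of 1. *)
Lemma open_centralizer_trivg (G : topGroupType) (x : G) (V : set G) :
  QZ G = [set 1] -> open V -> V 1 -> (forall v, V v -> commute x v) -> x = 1.
Proof.
move=> QZ_trivial oV V1 cV; suff : QZ G x by rewrite QZ_trivial.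
apply: (subgroup_open (V := V)) => //; split=> [|y z]; first exact: commute1.
by move=> cy cz; apply: commuteM => //; exact: commuteV.
Qed.

(** * Groups with a hereditarily just infinite compact open subgroup *)

Section LocallyHJI.
Variable G : topGroupType.
Implicit Types (N H E V W : set G) (g h x : G).

Hypothesis QZ_trivial : QZ G = [set 1].
Variable U : set G.
Hypotheses (sU : is_subgroup U) (cU : compact U) (oU : open U).
Hypothesis hjiU : hereditarily_just_infinite U.

Lemma not_open_trivg : ~ open [set 1 : G].
Proof.
move=> o1; have [_ + _] := hjiU.2 U sU (@subset_refl _ U) (open_subspaceW oU).
apply; apply: (compact_ind cU).
- exact: finite_set0.
- by move=> A B fA fB; rewrite finite_setU.
- by move=> A B; exact: sub_finite_set.
move=> x _; exists [set x]; split=> //.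
suff -> : [set x] = (fun y => x^-1 * y) @^-1` [set 1].
  by apply: open_preimage => //; exact: continuous_mulgl.
by apply/seteqP; split=> y /= => [->|/mulg1_eq]; rewrite ?mulVg ?invgK.
Qed.

(** The open subgroup [W] of [U] normalizes [N] and is just infinite, so [N] meets it trivially or
    in a subgroup of finite index. In the first case each element of [N] commutes with a
    neighbourhood of 1; in the second, removing finitely many closed cosets from [W] shows that the
    trace of [N] is open. *)
Lemma normalized_open N V :
  is_subgroup N -> closed N -> N <> [set 1] -> is_subgroup V -> open V ->
  (forall v, V v -> conj_set N v = N) -> open N.
Proof.
move=> sN cN N1 sV oV nN.
pose W := U `&` V; have oW : open W by exact: openI.
have sW : is_subgroup W := is_subgroupI sU sV.
have clW := open_subgroup_closed sW oW.
have nNW : is_normal (N `&` W) W.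
  apply/is_normalE; split=> //; first exact: (is_subgroupI sN sW).
  move=> w Ww; rewrite conj_setI (is_subgroup_conj_id sW) // nN //.
  by case: Ww.
have [_ _ jiW] := hjiU.2 W sW (@subIsetl _ U V) (open_subspaceW oW).
have [NW1|NW1] := pselect (N `&` W = [set 1]).
  case: N1; apply/seteqP; split=> [x Nx|_ ->]; last by case: sN.
  pose O := W `&` (fun u => x^-1 * x ^ u) @^-1` W.
  have oO : open O.
    apply: openI => //; apply: open_preimage => // u.
    apply: (@continuous_comp _ _ _ (fun u => x ^ u) (fun u => x^-1 * u)).
      exact: continuous_conjg_fun.
    exact: continuous_mulgl.
  apply: (open_centralizer_trivg QZ_trivial oO).
    by split; [case: sW|rewrite /= conjg1 mulVg; case: sW].
  move=> u [Wu Wxu]; apply/commgP/eqP; rewrite commgEl.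
  suff : (N `&` W) (x^-1 * x ^ u) by rewrite NW1.
  split=> //; apply: (is_subgroupM sN); first exact: (is_subgroupV sN).
  by rewrite -(nN u) //; [exists x|case: Wu].
have fin : finite_index (N `&` W) W.
  by apply: jiW => //; apply/closed_normalE => //; split=> //; exact: closedI.
pose C := [set A | lcosets (N `&` W) W A /\ A <> N `&` W].
have oNW : open (N `&` W).
  suff -> : N `&` W = W `&` ~` (\bigcup_(A in C) A).
    apply: openI => //; apply: closed_openC; apply: closed_bigcup.
      by apply: sub_finite_set fin => A [].
    move=> A [[w Ww <-] _].
    suff -> : mul w @` (N `&` W) = (fun y => w^-1 * y) @^-1` (N `&` W).
      have /continuous_closedP := @continuous_mulgl G w^-1; apply.
      exact: closedI.
    apply/seteqP; split=> y /=; first by move=> [z zNW <-]; rewrite mulKg.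
    by move=> ?; exists (w^-1 * y) => //; rewrite mulVKg.
  have [_ sNW _ _] := nNW.
  apply/seteqP; split=> x.
    move=> xNW; split; [by case: xNW|move=> [_ [[w Ww <-] wNW] [y yNW yx]]].
    apply: wNW; have wNW : (N `&` W) w.
      rewrite -[w](mulgK y) yx; exact: sNW.2.
    apply/seteqP; split=> z; first by move=> [z' zNW <-]; apply: (is_subgroupM sNW).
    move=> zNW; exists (w^-1 * z); last by rewrite mulVKg.
    by apply: (is_subgroupM sNW) => //; apply: (is_subgroupV sNW).
  move=> [Wx nC]; apply: contrapT => xNW; apply: nC.
  have xx : (mul x @` (N `&` W)) x by exists 1; [case: sNW|rewrite mulg1].
  exists (mul x @` (N `&` W)) => //; split; first by exists x.
  by move=> xE; apply: xNW; rewrite -xE.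
apply: (subgroup_open sN oNW); last exact: subIsetl.
by split; [case: sN|case: sW].
Qed.

(** That [U] is hereditarily just infinite enters the rest of the proof only through this fact and
    nondiscreteness. *)
Lemma closed_normal_open N E :
  is_subgroup E -> open E -> closed N -> is_normal N E -> N <> [set 1] -> open N.
Proof.
move=> sE oE cN /is_normalE[_ sN _ nN] N1.
exact: (normalized_open sN cN N1 sE oE nN).
Qed.

End LocallyHJI.

(** * Projection onto a quotient and generators of cyclic quotients *)

Lemma quotient_projection (G : groupType) (N H : set G) (nNH : is_normal N H) :
  exists pi : G -> quotient nNH,
    [/\ forall x y, H x -> H y -> pi (x * y) = pi x * pi y,
        forall C, exists2 x, H x & pi x = C,
        forall x y, H x -> H y -> pi x = pi y -> N (x^-1 * y) &
        forall x, N x -> pi x = 1].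
Proof.
have [sH sN NH cN] := nNH.
(* The guard [H x] leaves the projection arbitrary outside [H]. *)
pose P x (C : quotient nNH) := H x -> set_val C = mul x @` N.
have /choice[pi piE] : forall x, exists C, P x C.
  move=> x; have [Hx|nHx] := pselect (H x); last by exists 1.
  have xin : mul x @` N \in lcosets N H by apply/mem_set; exists x.
  by exists (exist (fun C => C \in lcosets N H) _ xin).
exists pi; split.
- move=> x y Hx Hy; apply: val_inj; rewrite [LHS]piE; last exact: (is_subgroupM sH).
  rewrite [RHS]/=; have := piE x Hx; have := piE y Hy; rewrite /set_val /= => -> ->.
  apply/seteqP; split=> z.
    move=> [n Nn <-]; exists x; first by exists 1; [case: sN|rewrite mulg1].
    by exists (y * n); [exists n|rewrite mulgA].
  move=> [_ [n Nn <-]] [_ [m Nm <-]] <-; exists (n ^ y * m).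
    by apply: (is_subgroupM sN) => //; exact: cN.
  by rewrite conjgE !mulgA mulgK.
- move=> C; have /set_mem[x Hx CE] := valP C; exists x => //.
  by apply: val_inj; rewrite [LHS]piE.
- move=> x y Hx Hy pixy; have := piE y Hy; rewrite -pixy piE // => xy.
  have : (mul y @` N) y by exists 1; [case: sN|rewrite mulg1].
  by rewrite -xy => -[n Nn <-]; rewrite mulKg.
- move=> x Nx; apply: val_inj; rewrite [LHS]piE; last exact: NH.
  apply/seteqP; split=> z; first by move=> [n Nn <-]; exact: (is_subgroupM sN).
  move=> Nz; exists (x^-1 * z); last by rewrite mulVKg.
  by apply: (is_subgroupM sN) => //; exact: (is_subgroupV sN).
Qed.

(** Lift a generator of the quotient to [c]: the elements of [S] in [H] have as image a subgroup
    containing that generator, hence the whole quotient. *)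
Lemma cyclic_quotient_generator (G : groupType) (N H : set G) (nNH : is_normal N H) :
  cyclic (quotient nNH) ->
  exists2 c, H c & forall S, is_subgroup S -> N `<=` S -> S c -> H `<=` S.
Proof.
move=> [C genC]; have [pi [piM piS piK piN]] := quotient_projection nNH.
have [sH sN NH _] := nNH; have [c Hc cC] := piS C.
exists c => // S sS NS Sc h Hh.
have pi1 : pi 1 = 1 by apply: piN; case: sN.
have piV x : H x -> pi x^-1 = (pi x)^-1.
  move=> Hx; apply/esym/mulg1_eq; rewrite -piM ?mulgV //.
  exact: (is_subgroupV sH).
pose D := [set C | exists x, [/\ H x, S x & pi x = C]].
have : D (pi h).
  have : [set: quotient nNH] (pi h) by [].
  rewrite genC; apply: smallest_sub => [|_ ->]; last by exists c.
  split=> [|_ _ [x [Hx Sx <-]] [y [Hy Sy <-]]].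
    by exists 1; split=> //; [case: sH|case: sS].
  exists (x / y); split; [exact: sH.2|exact: sS.2|].
  by rewrite piM ?piV //; exact: (is_subgroupV sH).
move=> [x [Hx Sx /(piK x h Hx Hh) Nxh]]; rewrite -[h](mulVKg x).
by apply: (is_subgroupM sS) => //; exact: NS.
Qed.

(** * Minimal sets, maximal normal subgroups and finite coset covers *)

Lemma Zorn_minimal (T : Type) (P : set (set T)) (L : set T) :
  P L ->
  (forall F, F !=set0 -> F `<=` P -> total_on F subset -> P (\bigcap_(X in F) X)) ->
  exists K, [/\ P K, K `<=` L & forall Q, P Q -> Q `<=` K -> Q = K].
Proof.
(* Zorn's lemma is applied to complements inside [L]. The empty chain yields [L] itself, so [Pcap]
   is called on nonempty chains only. *)
move=> PL Pcap; have [|A [PA maxA]] := @Zorn_bigcup T [set S | P (L `&` ~` S)].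
  move=> F FP Ftot; have [->|/set0P[S0 FS0]] := eqVneq F set0.
    by rewrite /= bigcup_set0 setC0 setIT.
  pose F' := [set L `&` ~` S | S in F].
  suff -> : [set S | P (L `&` ~` S)] (\bigcup_(X in F) X) = P (\bigcap_(X in F') X).
    apply: Pcap; first by exists (L `&` ~` S0), S0.
      by move=> _ [S FS <-]; exact: FP.
    move=> _ _ [S FS <-] [S' FS' <-].
    by case: (Ftot S S' FS FS') => SS'; [right|left] => x [Lx Sx]; split=> // /SS'.
  rewrite /=; congr P; apply/seteqP; split=> x.
    by move=> [Lx nx] _ [S FS <-]; split=> // Sx; apply: nx; exists S.
  move=> Fx; split; first by have [] := Fx (L `&` ~` S0) (ex_intro2 _ _ S0 FS0 erefl).
  by move=> [S FS Sx]; have [] := Fx (L `&` ~` S) (ex_intro2 _ _ S FS erefl).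
exists (L `&` ~` A); split=> // Q PQ QK; apply/seteqP; split=> // x [Lx Ax].
apply: contrapT => Qx; have := maxA (~` Q); apply.
  split=> [y Ay Qy|QA]; first by have [] := QK y Qy.
  exact/Ax/QA.
by rewrite /= setCK setIidr // => y /QK[].
Qed.

(** The finite-valued [phi] separates the cosets of [C]. Among the proper normal subgroups over [C],
    one with the largest image under [phi] is maximal: nested subgroups over [C] with equal images
    coincide. *)
Lemma finite_quotient_maximal_normal (G : groupType) (E C : set G)
    (F : finType) (phi : G -> F) :
  is_normal C E -> C <> E ->
  (forall e f, E e -> E f -> phi e = phi f -> C (e / f)) ->
  exists A, [/\ is_normal A E, C `<=` A, A <> E &
    forall B, is_normal B E -> A `<=` B -> B = A \/ B = E].
Proof.
move=> nC CE phiC.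
pose im A v := `[< exists2 e, A e & phi e = v >].
pose P n := `[< exists A, [/\ is_normal A E, C `<=` A, A <> E & #|im A| = n] >].
have exP : exists n, P n by exists #|im C|; apply/asboolP; exists C; split.
have boundP n : P n -> (n <= #|F|)%N.
  by move=> /asboolP[A [_ _ _ <-]]; exact: max_card.
case: (ex_maxnP exP boundP) => n /asboolP[A [nA CA AE An]] maxn.
exists A; split=> // B nB AB; have [->|BE] := pselect (B = E); [by right|left].
have imAB : im A \subset im B.
  apply/fintype.subsetP => v /asboolP[e Ae <-]; apply/asboolP.
  by exists e => //; exact: AB.
have imE : im A =i im B.
  apply/subset_cardP => //; apply/eqP.
  rewrite eqn_leq subset_leq_card //= An; apply: maxn; apply/asboolP.
  by exists B; split=> //; apply: subset_trans CA AB.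
apply/seteqP; split=> // b Bb.
have [sE sA AsE _] := nA; have [_ _ BsE _] := nB.
have : phi b \in im A by rewrite imE; apply/asboolP; exists b.
move=> /asboolP[e Ae phie]; rewrite -[b](mulgVK e).
apply: (is_subgroupM sA) => //; apply: CA; apply: phiC => //.
- exact: BsE.
- exact: AsE.
Qed.

Lemma compact_lcoset_cover (G : topGroupType) (W N : set G) :
  compact W -> open N -> is_subgroup N ->
  exists s : seq G, (forall w, w \in s -> W w) /\
    (forall w, W w -> exists2 v, v \in s & N (v^-1 * w)).
Proof.
move=> cW oN sN; suff [s [sW sN']] : exists s : seq G,
    (forall w, w \in s -> W w) /\
    (forall w, W w -> W w -> exists2 v, v \in s & N (v^-1 * w)).
  by exists s; split=> // w Ww; apply: sN'.
apply: (compact_ind cW (P := fun A => exists s : seq G,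
    (forall w, w \in s -> W w) /\
    (forall w, A w -> W w -> exists2 v, v \in s & N (v^-1 * w)))).
- by exists [::].
- move=> A B [s [sW sA]] [s' [s'W sB]]; exists (s ++ s'); split.
    by move=> w; rewrite mem_cat => /orP[/sW|/s'W].
  by move=> w [/sA|/sB] wN /wN[v vs ?]; exists v => //; rewrite mem_cat vs ?orbT.
- by move=> A B AB [s [sW sB]]; exists s; split=> // w /AB/sB.
move=> x Wx; exists ((fun y => x^-1 * y) @^-1` N); split.
- by apply: open_preimage => //; exact: continuous_mulgl.
- by rewrite /= mulVg; case: sN.
- by exists [:: x]; split=> [w|w Nw Ww]; [|exists x]; rewrite ?inE // => /eqP->.
Qed.

(** * Groups whose open subgroups have only open nontrivial closed normal subgroups *)

Section LocallyNormal.
Variable G : topGroupType.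
Hypothesis QZ_trivial : QZ G = [set 1].
Hypothesis nondiscrete : ~ open [set 1 : G].
Hypothesis normal_open : forall N E : set G, is_subgroup E -> open E ->
  closed N -> is_normal N E -> N <> [set 1] -> open N.
Implicit Types (N H E U V W : set G) (g h x : G).

Lemma open_neq_trivg N : open N -> N <> [set 1].
Proof. by move=> oN N1; apply: nondiscrete; rewrite -N1. Qed.

Lemma exists_nontrivial N : open N -> N 1 -> exists2 x, N x & x <> 1.
Proof.
move=> oN N1; apply: contrapT => nN; apply: (open_neq_trivg oN).
apply/seteqP; split=> [x Nx|_ -> //]; apply: contrapT => x1.
by apply: nN; exists x.
Qed.

(* An open subgroup E acts on W / (W `&` N) for N an open normal subgroup; as
   this action is nontrivial for some N, its kernel lies below a maximal proper
   normal subgroup. *)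
Lemma exists_maximal_normal E W :
  is_subgroup E -> open E ->
  (forall x, (forall N, open N -> is_normal N E -> N x) -> x = 1) ->
  compact W -> open W -> is_normal W E ->
  exists A, [/\ open A, is_normal A E, A <> E &
    forall B, is_normal B E -> A `<=` B -> B = A \/ B = E].
Proof.
move=> sE oE resE cW oW nW; have [_ sW WE conjW] := nW.
have [w0 Ww0 w0N1] : exists2 x, W x & x <> 1 by apply: exists_nontrivial; case: sW.
have [e0 Ee0 ew0] : exists2 e, E e & [~ w0, e] <> 1.
  apply: contrapT => nE; apply: w0N1.
  apply: (open_centralizer_trivg QZ_trivial oE); first by case: sE.
  move=> e Ee; apply/commgP/eqP; apply: contrapT => ew; apply: nE.
  by exists e.
have [N [oN nN ew0N]] : exists N, [/\ open N, is_normal N E & ~ N [~ w0, e0]].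
  apply: contrapT => nNE; apply: ew0; apply: resE => N oN nN.
  by apply: contrapT => ?; apply: nNE; exists N.
have [_ sN NE conjN] := nN.
have conjWS h : E h -> conj_set W h `<=` W by move=> Eh _ [x Wx <-]; apply: conjW.
have nC := is_normal_centralizer_mod nN WE conjWS.
have NC := sub_centralizer_mod nN WE.
set C := [set h | _] in nC NC.
have oC : open C by apply: (subgroup_open _ oN) => //; [case: nC|case: sN].
have CE : C <> E by move=> CE; apply: ew0N; move: Ee0; rewrite -CE => -[_]; apply.
have [s [sW' sNW]] := compact_lcoset_cover cW oN sN.
(* Entry (i, j) tells whether [e] carries the coset of the i-th representative to that of the j-th:
   [phi e] is the matrix of the action of [e]. *)
pose phi e : {ffun 'I_(size s) * 'I_(size s) -> bool} :=
  [ffun ij : 'I_(size s) * 'I_(size s) => `[< N ((s`_(ij.2))^-1 * s`_(ij.1) ^ e) >]].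
have [|A [nA CA AE maxA]] :=
    @finite_quotient_maximal_normal G E C _ phi nC CE; last first.
  exists A; split=> //; apply: (subgroup_open _ oN); first by case: nA.
    by case: sN.
  exact: subset_trans NC CA.
move=> e f Ee Ef phief; split; first exact: sE.2.
move=> w Ww; have [v vs Nvw] := sNW w Ww.
have Wve : W (v ^ e) by apply: conjW => //; exact: sW'.
have [u us Nue] := sNW _ Wve.
have Nuf : N (u^-1 * v ^ f).
  have vi : (index v s < size s)%N by rewrite index_mem.
  have ui : (index u s < size s)%N by rewrite index_mem.
  move: phief => /ffunP/(_ (Ordinal vi, Ordinal ui)); rewrite !ffunE /=.
  rewrite !nth_index // => fE; apply/asboolP; rewrite -fE; exact/asboolP.
have Nef : N ((v ^ f)^-1 * v ^ e).
  have := is_subgroupM sN (is_subgroupV sN Nuf) Nue.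
  by rewrite invgM invgK -mulgA mulVKg.
have Nvef : N (v^-1 * v ^ (e / f)).
  have := conjN _ _ (is_subgroupV sE Ef) Nef.
  by rewrite conjMg conjVg conjgK conjgM.
have -> : [~ w, e / f] =
    ((v^-1 * w)^-1 * (v^-1 * v ^ (e / f))) * (v^-1 * w) ^ (e / f).
  have eqE (a b c d : G) :
      a^-1 * d = (b^-1 * a)^-1 * (b^-1 * c) * (c^-1 * d).
    by rewrite invgM invgK -!mulgA !mulVKg.
  by rewrite commgEl (conjMg v^-1 w) conjVg -eqE.
apply: (is_subgroupM sN).
  by apply: (is_subgroupM sN) => //; exact: (is_subgroupV sN).
by apply: conjN => //; exact: sE.2.
Qed.

(* Let A be a maximal proper normal subgroup of E. Its conjugates
   under the normalizer of E intersect
   trivially, so E / A is not abelian and A is prime: two normal subgroups of E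
   that are not inside A do not intersect inside A. By compactness of W `\` A the
   intersection D of all open normal subgroups not inside A is nontrivial, hence
   open; but D `&` A lies in every conjugate of A. *)
Lemma no_compact_open_normal E W :
  is_subgroup E -> open E ->
  (forall N, open N -> is_normal N E ->
     (forall t, conj_set E t = E -> conj_set N t = N) -> N = E) ->
  (forall x, (forall N, open N -> is_normal N E -> N x) -> x = 1) ->
  compact W -> open W -> is_normal W E -> False.
Proof.
move=> sE oE simpleE resE cW oW nW.
pose T := [set t | conj_set E t = E].
have sT : is_subgroup T by exact: normalizer_is_subgroup.
have TE t : T t -> conj_set E t = E by [].
have [A0 [oA0 nA0 A0E maxA0]] := exists_maximal_normal sE oE resE cW oW nW.
pose I := \bigcap_(t in T) conj_set A0 t.
have nconj t : T t -> is_normal (conj_set A0 t) E.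
  by move=> /TE; exact: is_normal_conj.
have oconj t : open (conj_set A0 t) by exact: open_conj.
have T1 : T 1 by case: sT.
have clI : closed I.
  apply: closed_bigI => t /nconj[_ sA _ _]; exact: open_subgroup_closed.
have nI : is_normal I E by apply: is_normal_bigcap => //; exists 1.
(* Conjugation by [T] preserves [I], so a nontrivial [I] would be open and equal to [E] by
   [simpleE], although it lies in [A0]. *)
have I1 : I = [set 1].
  apply: contrapT => I1; apply: A0E; apply/seteqP; split; first by case: nA0.
  suff <- : I = E by move=> x /(_ 1 T1); rewrite conj_set1.
  apply: simpleE => //; first exact: (normal_open sE oE clI nI I1).
  move=> s Ts; apply/seteqP; split=> x; rewrite conj_setE => Ix t Tt.
    rewrite -[t](mulgVK s) -conj_setM conj_setE; apply: Ix.
    exact: sT.2.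
  rewrite -conj_setE conj_setM; apply: Ix; exact: (is_subgroupM sT).
have [_ sW WE _] := nW.
have [t0 Tt0 WA0] : exists2 t, T t & ~ W `<=` conj_set A0 t.
  apply: contrapT => nt; have [w Ww w1] : exists2 x, W x & x <> 1.
    by apply: exists_nontrivial => //; case: sW.
  apply: w1; suff : I w by rewrite I1.
  move=> t Tt; apply: contrapT => Aw; apply: nt; exists t => // WA.
  by apply: Aw; exact: WA.
pose A := conj_set A0 t0.
have maxA t B : T t -> is_normal B E -> conj_set A0 t `<=` B ->
    B = conj_set A0 t \/ B = E.
  move=> Tt nB AB; have TtV := is_subgroupV sT Tt.
  case: (maxA0 (conj_set B t^-1)) => [||BA|BE].
  - by apply: is_normal_conj => //; exact: TE.
  - by rewrite -[A0](conj_setK _ t); exact: conj_setS.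
  - by left; rewrite -BA conj_setKV.
  - by right; rewrite -[B](conj_setKV _ t) BE TE.
have properA t : T t -> conj_set A0 t <> E.
  move=> Tt AE; apply: A0E; rewrite -[A0](conj_setK _ t) AE TE //.
  exact: (is_subgroupV sT).
have nA : is_normal A E := nconj _ Tt0.
have [_ sA AE conjA] := nA.
(* If E / A were abelian, commutators of [E] would lie in every conjugate of [A], hence in [I], and
   [E] would be abelian. *)
have nonabelian : ~ forall x y, E x -> E y -> A [~ x, y].
  move=> Aab; have [x Ex x1] : exists2 x, E x & x <> 1.
    by apply: exists_nontrivial => //; case: sE.
  apply: x1; apply: (open_centralizer_trivg QZ_trivial oE); first by case: sE.
  move=> y Ey; apply/commgP/eqP; suff : I [~ x, y] by rewrite I1.
  move=> t Tt; rewrite -[t](mulVKg t0) -conj_setM -/A conj_setE conjRg.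
  have Tu : T (t0^-1 * t)^-1.
    apply: (is_subgroupV sT); apply: (is_subgroupM sT) => //.
    exact: (is_subgroupV sT).
  by apply: Aab; rewrite -(TE _ Tu); [exists x|exists y].
have conjS N h : is_normal N E -> E h -> conj_set N h `<=` N.
  by move=> nN Eh; rewrite (is_normal_sub nN Eh).
(* If the intersection were inside [A], then [N2] would centralize [N1] modulo [A]. By maximality
   that centralizer is [E]; then the centralizer of [E] modulo [A] contains [N1] and is also [E],
   against [nonabelian]. *)
have prime N1 N2 : is_normal N1 E -> is_normal N2 E ->
    ~ N1 `<=` A -> ~ N2 `<=` A -> exists2 x, (N1 `&` N2) x & ~ A x.
  move=> nN1 nN2 N1A N2A; apply: contrapT => nx.
  have N12A : N1 `&` N2 `<=` A.
    by move=> x N12x; apply: contrapT => Ax; apply: nx; exists x.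
  have [_ sN1 N1E conjN1] := nN1; have [_ sN2 N2E conjN2] := nN2.
  have conjN1S h Eh := conjS N1 h nN1 Eh.
  have nEE := is_normal_refl sE.
  have conjES h Eh := conjS E h nEE Eh.
  case: (maxA t0 _ Tt0 (is_normal_centralizer_mod nA N1E conjN1S)).
  - exact: sub_centralizer_mod.
  - move=> C1A; apply: N2A => y N2y; rewrite /A -C1A; split; first exact: N2E.
    move=> x N1x; apply: N12A; split.
      rewrite commgEl; apply: (is_subgroupM sN1); first exact: (is_subgroupV sN1).
      by apply: conjN1 => //; exact: N2E.
    rewrite commgEr; apply: (is_subgroupM sN2) => //; apply: conjN2; first exact: N1E.
    exact: (is_subgroupV sN2).
  move=> C1E.
  case: (maxA t0 _ Tt0 (is_normal_centralizer_mod nA (@subset_refl _ E) conjES)).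
  - exact: sub_centralizer_mod.
  - move=> C2A; apply: N1A => x N1x; rewrite /A -C2A; split; first exact: N1E.
    move=> y; rewrite -{1}C1E => -[_ /(_ x N1x) Axy].
    by rewrite -invgR; exact: (is_subgroupV sA).
  move=> C2E; apply: nonabelian => x y Ex.
  by rewrite -{1}C2E => -[_]; apply.
pose F := [set N | [/\ open N, is_normal N E & ~ N `<=` A]].
have cWA : compact (W `&` ~` A).
  by apply: compact_closedI => //; exact: open_closedC (oconj t0).
have [||||d [Wd Ad] dF] := compact_directed cWA (F := F).
- by exists W.
- move=> N1 N2 [oN1 nN1 N1A] [oN2 nN2 N2A]; exists (N1 `&` N2) => //.
  split; [exact: openI|exact: is_normalI|move=> N12A].
  by have [x /N12A] := prime _ _ nN1 nN2 N1A N2A.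
- by move=> N [oN [_ sN _ _] _]; exact: open_subgroup_closed.
- move=> N [oN nN NA]; have [x [Wx Nx] Ax] := prime _ _ nW nN WA0 NA.
  by exists x.
pose D := \bigcap_(N in F) N.
have nD : is_normal D E by apply: is_normal_bigcap => [//||N []//]; exists W.
have oD : open D.
  apply: (normal_open sE oE _ nD).
    by apply: closed_bigI => N [oN [_ sN _ _] _]; exact: open_subgroup_closed.
  move=> D1; apply: Ad; have : D d by [].
  by rewrite D1 => ->; case: sA.
apply: (@open_neq_trivg (D `&` A)); first exact: openI oD (oconj t0).
apply/seteqP; split=> [x [Dx Ax]|_ ->]; last first.
  by split; [case: nD => _ []|case: sA].
suff : I x by rewrite I1.
(* A conjugate not inside [A] belongs to [F] and so contains [D]; one inside [A] equals [A] by
   maximality. *)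
move=> t Tt; have [AtA|AtA] := pselect (conj_set A0 t `<=` A); last first.
  by apply: Dx; split=> //; exact: nconj.
by have [<-//|AE'] := maxA t _ Tt nA AtA; case: (properA _ Tt0).
Qed.

(** Finitely many cosets U x cover the compact generating set. [X] collects the representatives and
    [V] intersects the matching conjugates of [U]; the induction carries the open [V] along in place
    of the finiteness of [X]. *)
Lemma compactly_generated_over_open (U H : set G) :
  is_subgroup U -> open U -> U `<=` H -> compactly_generated H ->
  exists X V, [/\ open V, is_subgroup V, X `<=` H,
    forall x, X x -> V `<=` conj_set U x /\ V `<=` conj_set U x^-1 &
    forall S, is_subgroup S -> U `<=` S -> X `<=` S -> H `<=` S].
Proof.
move=> sU oU UH [Y cY HY].
pose P A := exists X V, [/\ open V, is_subgroup V, X `<=` H,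
    forall x, X x -> V `<=` conj_set U x /\ V `<=` conj_set U x^-1 &
    forall a, A a -> H a -> exists2 x, X x & U (a / x)].
have [|A B|A B AB|y Yy|X [V [oV sV XH XV YX]]] := compact_ind cY (P := P).
- by exists set0, setT; split=> //; exact: openT.
- move=> [X [V [oV sV XH XV AX]]] [X' [V' [oV' sV' XH' XV' BX']]].
  exists (X `|` X'), (V `&` V'); split.
  + exact: openI.
  + exact: is_subgroupI.
  + by move=> x [/XH|/XH'].
  + by move=> x [/XV|/XV'] [VU VU']; split=> v [Vv V'v]; auto.
  + move=> a [/AX|/BX'] aX /aX[x Xx ?]; exists x => //; by [left|right].
- move=> [X [V [oV sV XH XV BX]]]; exists X, V; split=> // a /AB; exact: BX.
- have oconjU g : open (conj_set U g) by exact: open_conj.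
  have sconjU g : is_subgroup (conj_set U g) by exact: is_subgroup_conj.
  exists ((fun a => a * y^-1) @^-1` U); split.
  + by apply: open_preimage => //; exact: continuous_mulgr.
  + by rewrite /= mulgV; case: sU.
  have Hy : H y by rewrite HY => S [_ YS]; exact: YS.
  exists [set y], (conj_set U y `&` conj_set U y^-1); split.
  + exact: openI (oconjU _) (oconjU _).
  + exact: is_subgroupI (sconjU _) (sconjU _).
  + by move=> _ ->.
  + by move=> _ ->; split=> v [].
  + by move=> a Ua _; exists y.
exists X, V; split=> // S sS US XS; rewrite {1}HY; apply: smallest_sub => // y Yy.
have Hy : H y by rewrite HY => S' [_ YS']; exact: YS'.
have [x Xx Uyx] := YX y Yy Hy; rewrite -[y](mulgVK x).
by apply: (is_subgroupM sS); [exact: US|exact: XS].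
Qed.

(** * Open normal subgroups of an open normal subgroup [R], and their conjugates *)

Section OpenNormalSubgroup.
Variables R U : set G.
Hypotheses (sR : is_subgroup R) (oR : open R).
Hypothesis R_normal : forall g, conj_set R g = R.
Hypothesis R_no_compact : forall W, compact W -> open W -> ~ is_normal W R.
Hypotheses (sU : is_subgroup U) (cU : compact U) (oU : open U) (UR : U `<=` R).

Lemma clR : closed R. Proof. exact: open_subgroup_closed. Qed.

(* If V contained every Q ^ h `&` U with h in H, then H would normalize Q `&` U. *)
Lemma conj_escape H X V Q :
  is_subgroup H -> R `<=` H -> X `<=` H ->
  (forall x, X x -> V `<=` conj_set U x /\ V `<=` conj_set U x^-1) ->
  (forall S, is_subgroup S -> U `<=` S -> X `<=` S -> H `<=` S) ->
  open Q -> is_normal Q R ->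
  exists2 h, H h & exists2 x, (conj_set Q h `&` U) x & ~ V x.
Proof.
move=> sH RH XH XV genH oQ nQ; apply: contrapT => nh.
have QUV g : H g -> conj_set Q g `&` U `<=` V.
  by move=> Hg x QUx; apply: contrapT => Vx; apply: nh; exists g => //; exists x.
(* Quantifying over all [H]-conjugates of [Q] is what makes [S] a subgroup. *)
pose S := [set h | H h /\
  forall g, H g -> conj_set Q g `&` conj_set U h = conj_set Q g `&` U].
have sS : is_subgroup S.
  split=> [|h k [Hh Sh] [Hk Sk]].
    by split; [case: sH|move=> g _; rewrite conj_set1].
  split=> [|g Hg]; first exact: sH.2.
  have Hgk : H (g * k) by exact: (is_subgroupM sH).
  rewrite -{1}(mulgK k g) -!conj_setM -conj_setI conj_setM (Sh _ Hgk) -(Sk _ Hgk).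
  by rewrite conj_setI !conj_setM mulgK mulgV conj_set1.
have HS : H `<=` S.
  apply: genH => //.
    move=> u Uu; split; first exact/RH/UR.
    by move=> g _; rewrite (is_subgroup_conj_id sU Uu).
  move=> x Xx; have [VU VU'] := XV x Xx; split; first exact: XH.
  move=> g Hg; apply/seteqP; split=> y [Qy Uy]; split=> //; last first.
    by apply: VU; apply: (QUV g).
  have : V (y ^ x^-1).
    apply: (QUV (g * x^-1)).
      apply: (is_subgroupM sH) => //; apply: (is_subgroupV sH); exact: XH.
    by rewrite -conj_setM; split; rewrite -conj_setE ?conj_setKV.
  by move=> /VU'; rewrite -conj_setE conj_setKV.
apply: (@R_no_compact (Q `&` U)).
- rewrite setIC; apply: compact_closedI => //.
  by have [_ sQ _ _] := nQ; exact: open_subgroup_closed.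
- exact: openI.
- apply/is_normalE; split=> //.
  + by case: nQ => _ sQ _ _; exact: (is_subgroupI sQ sU).
  + by move=> x [_ /UR].
  move=> r Rr; rewrite conj_setI (is_normal_sub nQ Rr).
  have [_ /(_ 1)] := HS _ (RH _ Rr); rewrite conj_set1; apply.
  by case: sH.
Qed.

(** An open [H]-invariant subgroup of [R] equals its [H]-conjugates, so by [conj_escape] it meets
    [U] outside [V]. By compactness the intersection of all of them does too; being nontrivial, it
    is open. *)
Lemma Res_in_open H :
  is_subgroup H -> compactly_generated H -> R `<=` H -> open (Res_in R H).
Proof.
move=> sH cgH RH; have UH : U `<=` H by exact: subset_trans UR RH.
have [X [V [oV sV XH XV genH]]] := compactly_generated_over_open sU oU UH cgH.
pose F := [set N : set G | [/\ open (N : set (subspace R)), is_subgroup N,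
  N `<=` R & forall h, H h -> conj_set N h = N]].
have FP N : F N -> open N /\ is_normal N R.
  move=> [oN sN NR cN]; apply/open_normalE => //; split=> //.
  by apply/is_normalE; split=> // r /RH; exact: cN.
have FR : F R by split=> //; exact: open_subspaceT.
have cUV : compact (U `&` ~` V) by apply: compact_closedI => //; exact: open_closedC.
have [||||d [Ud Vd] dF] := compact_directed cUV (F := F).
- by exists R.
- move=> A B [oA sA AR cA] [oB sB BR cB]; exists (A `&` B) => //; split.
  + exact: openI.
  + exact: is_subgroupI.
  + by move=> x [/AR].
  + by move=> h Hh; rewrite conj_setI cA // cB.
- by move=> N /FP[oN [_ sN _ _]]; exact: open_subgroup_closed.
- move=> N FN; have [oN nN] := FP _ FN; have [_ _ _ cN] := FN.
  have [h Hh [x [Nx Ux] Vx]] := conj_escape sH RH XH XV genH oN nN.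
  by exists x; split=> //; rewrite -(cN _ Hh).
apply: (normal_open sR oR).
- by apply: closed_bigI => N /FP[oN [_ sN _ _]]; exact: open_subgroup_closed.
- by apply: is_normal_bigcap => //; [exists R|move=> N /FP[]].
- move=> R1; apply: Vd; have : Res_in R H d by [].
  by rewrite R1 => ->; case: sV.
Qed.

(** * Minimal open normal subgroups meeting [U] outside [V] *)

Section MinimalNormal.
Variable V : set G.
Hypotheses (sV : is_subgroup V) (oV : open V).

Let F := [set Q : set G | [/\ open Q, is_normal Q R & (Q `&` U) `\` V !=set0]].

Let cUV : compact (U `\` V).
Proof. by apply: compact_closedI => //; exact: open_closedC. Qed.

(** By compactness the intersection of a chain in [F] still meets [U] outside [V]; being nontrivial,
    it is again open. *)
Lemma exists_minimal_escaping L : F L ->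
  exists K, [/\ F K, K `<=` L & forall Q, F Q -> Q `<=` K -> Q = K].
Proof.
move=> FL; apply: Zorn_minimal => // C C0 CF Ctot.
have [A B CA CB|A /CF[oA [_ sA _ _] _]|A /CF[_ _ [x [[Ax Ux] Vx]]]|d [Ud Vd] dC] :=
  compact_directed cUV C0.
- by case: (Ctot A B CA CB) => AB; [exists A|exists B] => // x; split=> //; exact: AB.
- exact: open_subgroup_closed.
- by exists x.
have nC : is_normal (\bigcap_(X in C) X) R by apply: is_normal_bigcap => // A /CF[].
split=> //; last by exists d.
apply: (normal_open sR oR) => //.
  by apply: closed_bigI => A /CF[oA [_ sA _ _] _]; exact: open_subgroup_closed.
move=> C1; apply: Vd; have : (\bigcap_(X in C) X) d by [].
by rewrite C1 => ->; case: sV.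
Qed.

(* K lies in the limit L of the open normal subgroups of R passing near e: a is in
   L when every such subgroup passing close enough to e passes close to a. *)
Lemma minimal_escaping_near e : (U `\` V) e ->
  exists K O, [/\ F K, open O, O e &
    forall Q, open Q -> is_normal Q R -> Q `&` O !=set0 -> K `<=` Q].
Proof.
move=> [Ue Ve].
pose L := [set a | R a /\ forall O, nbhs a O -> exists2 O', nbhs e O' &
  forall Q : set G, open Q -> is_normal Q R -> Q `&` O' !=set0 -> Q `&` O !=set0].
have sL : is_subgroup L.
  split=> [|a b [Ra La] [Rb Lb]].
    split=> [|O O1]; first by case: sR.
    exists setT => [|Q _ [_ [Q1 _] _ _] _]; first exact: filterT.
    by exists 1; split=> //; exact: nbhs_singleton.
  split=> [|O Oab]; first exact: sR.2.
  have [[A B0] [/= aA bB0] AB] := @mulg_continuous G (a, b^-1) O Oab.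
  pose B := (fun y : G => y^-1) @^-1` B0; have bB : nbhs b B := @invg_continuous G b _ bB0.
  have [A' eA' QA] := La A aA; have [B' eB' QB] := Lb B bB.
  exists (A' `&` B') => [|Q oQ nQ [q [Qq [A'q B'q]]]]; first exact: filterI.
  have [x [Qx Ax]] := QA Q oQ nQ (ex_intro _ q (conj Qq A'q)).
  have [y [Qy By]] := QB Q oQ nQ (ex_intro _ q (conj Qq B'q)).
  exists (x / y); split; last exact: (AB (x, y^-1)).
  by case: nQ => _ [_ sQ] _ _; exact: sQ.
have nL : is_normal L R.
  split=> // [a []//|r a Rr [Ra La]]; split=> [|O Oar].
    by apply: (is_subgroupM sR); [exact: (is_subgroupV sR)|exact: (is_subgroupM sR)].
  have [O' eO' QO] := La _ (@continuous_conjg G r a _ Oar).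
  exists O' => // Q oQ nQ QO'; have [x [Qx Ox]] := QO Q oQ nQ QO'.
  by exists (x ^ r); split=> //; case: nQ => _ _ _; apply.
have clL : closed L.
  move=> a La; split; first by apply: clR => O /La[b [[Rb _] Ob]]; exists b.
  move=> O /nbhs_interior/La[b [[_ Lb] Ob]]; exact: Lb.
have Le : L e by split=> [|O eO]; [exact: UR|exists O].
have oL : open L.
  apply: (normal_open sR oR) => // L1; apply: Ve.
  by move: Le; rewrite L1 => ->; case: sV.
have [K [FK KL minK]] : exists K, [/\ F K, K `<=` L & forall Q, F Q -> Q `<=` K -> Q = K].
  by apply: exists_minimal_escaping; split=> //; exists e.
have [oK nK [a [[Ka Ua] Va]]] := FK; have [_ La] := KL a Ka.
(* A subgroup passing near [e] passes near [a], so it meets [K] in [U] outside [V]; minimality of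
   [K] then puts [K] inside it. *)
have [|O' eO' QO'] := La ((K `&` U) `\` V).
  apply: open_nbhs_nbhs; split=> //; apply: openI; first exact: openI.
  by apply: closed_openC; exact: open_subgroup_closed.
exists K, (interior O'); split=> //; first exact: open_interior.
move=> Q oQ nQ [q [Qq /interior_subset O'q]].
have [x [Qx [[Kx Ux] Vx]]] := QO' Q oQ nQ (ex_intro _ q (conj Qq O'q)).
rewrite -(minK (Q `&` K)) //; split.
- exact: openI.
- exact: is_normalI.
- by exists x.
Qed.

(** Compactness yields a set [Ks] of members of [F], one below each member of [F], and an open
    normal [D] below all of [Ks]. A conjugate of [D] lies in [F], so it contains some [K] in [Ks].
    As each [Q] has a conjugate containing a member of [Ks], hence [D], this [K] is the desired
    one. *)
Lemma escaping_conj_minimum :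
  (forall Q, open Q -> is_normal Q R -> exists g, F (conj_set Q g)) ->
  exists K, [/\ open K, is_normal K R &
    forall Q, open Q -> is_normal Q R -> exists g, conj_set K g `<=` Q].
Proof.
move=> escF.
pose P A := exists Ks D, [/\ Ks `<=` F, open D, is_normal D R,
  forall K, Ks K -> D `<=` K &
  forall Q, open Q -> is_normal Q R -> Q `&` A !=set0 -> exists2 K, Ks K & K `<=` Q].
have [|A B|A B AB|e /minimal_escaping_near[K [O [FK oO Oe KQ]]]|] :=
  compact_ind cUV (P := P).
- by exists set0, R; split=> //; [exact: is_normal_refl|move=> Q _ _ [x []]].
- move=> [Ks [D [KsF oD nD DKs KsA]]] [Ks' [D' [KsF' oD' nD' DKs' KsB]]].
  exists (Ks `|` Ks'), (D `&` D'); split.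
  + by move=> K [/KsF|/KsF'].
  + exact: openI.
  + exact: is_normalI.
  + by move=> K [/DKs DK|/DKs' DK] x [Dx D'x]; exact: DK.
  + move=> Q oQ nQ [x [Qx [Ax|Bx]]].
      have [K KsK KQ] := KsA Q oQ nQ (ex_intro _ x (conj Qx Ax)).
      by exists K => //; left.
    have [K KsK KQ] := KsB Q oQ nQ (ex_intro _ x (conj Qx Bx)).
    by exists K => //; right.
- move=> [Ks [D [KsF oD nD DKs KsB]]]; exists Ks, D; split=> // Q oQ nQ [x [Qx /AB Bx]].
  by apply: KsB => //; exists x.
- exists O; split=> //; exists [set K], K; split=> //.
  + by move=> _ ->.
  + by case: FK.
  + by case: FK.
  + by move=> _ ->.
  + by move=> Q oQ nQ /(KQ Q oQ nQ) ?; exists K.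
move=> Ks [D [KsF oD nD DKs KsUV]].
have KsQ Q : F Q -> exists2 K, Ks K & K `<=` Q.
  by move=> [oQ nQ [x [[Qx Ux] Vx]]]; apply: KsUV => //; exists x.
have [h /KsQ[K KsK KDh]] := escF D oD nD.
have [oK nK _] := KsF K KsK; exists K; split=> // Q oQ nQ.
have [g /KsQ[K' KsK' KQg]] := escF Q oQ nQ.
exists (g * h)^-1; apply: conj_setSV; rewrite invgK -conj_setM.
apply: subset_trans KDh (conj_setS _).
by apply: subset_trans KQg; exact: DKs.
Qed.

End MinimalNormal.

Lemma conj_minimum :
  compactly_generated [set: G] ->
  exists K, [/\ open K, is_normal K R &
    forall Q, open Q -> is_normal Q R -> exists g, conj_set K g `<=` Q].
Proof.
move=> cgG; have sG : is_subgroup [set: G] by [].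
have [X [V [oV sV XH XV genH]]] := compactly_generated_over_open sU oU (@subsetT _ U) cgG.
apply: (escaping_conj_minimum sV oV) => Q oQ nQ.
have [h _ [x QUx Vx]] := conj_escape sG (@subsetT _ R) XH XV genH oQ nQ.
by exists h; split; [exact: open_conj|exact: is_normal_conj|exists x].
Qed.

(* Otherwise, after replacing Q by its conjugate by a large power of t, t maps
   Y := Q `&` U into itself and the conjugates of Y by powers of t are compact
   open normal subgroups of their union E, against no_compact_open_normal. *)
Lemma contracting_conj_bigcap t Q :
  open Q -> is_normal Q R -> conj_set Q t `<=` Q ->
  exists2 x, x <> 1 & forall n, conj_set Q (t ^+ n) x.
Proof.
move=> oQ nQ QtQ; apply: contrapT => Qt1.
have {}Qt1 x : (forall n, conj_set Q (t ^+ n) x) -> x = 1.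
  by move=> Qx; apply: contrapT => x1; apply: Qt1; exists x.
have Qdecr m n : (m <= n)%N -> conj_set Q (t ^+ n) `<=` conj_set Q (t ^+ m).
  move=> /subnKC <-; elim: (n - m)%N => [|k IH]; first by rewrite addn0.
  apply: subset_trans IH; rewrite addnS expgS -conj_setM.
  exact: conj_setS.
have oQn n : open (conj_set Q (t ^+ n)) by exact: open_conj.
have nQn n : is_normal (conj_set Q (t ^+ n)) R by exact: is_normal_conj.
have sQn n : is_subgroup (conj_set Q (t ^+ n)) by case: (nQn n).
have clQn n : closed (conj_set Q (t ^+ n)) by exact: open_subgroup_closed.
(* Conjugation by [t] and by its inverse both send [V] into [U]. *)
pose V := conj_set U t `&` conj_set U t^-1.
have oV : open V by apply: openI; exact: open_conj.
have [k QkV] : exists k, conj_set Q (t ^+ k) `&` U `<=` V.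
  apply: contrapT => nk.
  have cUV : compact (U `\` V).
    by apply: compact_closedI => //; exact: open_closedC.
  have [||||d [Ud Vd] dQ] :=
      compact_directed cUV (F := range (fun n => conj_set Q (t ^+ n))).
  - by exists (conj_set Q (t ^+ 0)), 0%N.
  - move=> _ _ [m _ <-] [n _ <-]; exists (conj_set Q (t ^+ maxn m n)).
      by exists (maxn m n).
    by rewrite subsetI; split; apply: Qdecr; rewrite ?leq_maxl ?leq_maxr.
  - by move=> _ [n _ <-].
  - move=> _ [n _ <-]; apply: contrapT => UVQ; apply: nk; exists n => x [Qx Ux].
    by apply: contrapT => Vx; apply: UVQ; exists x.
  apply: Vd; rewrite (Qt1 d) => [|n]; last by apply: dQ; exists n.
  by split; rewrite conj_setE conj1g; case: sU.
pose Y := conj_set Q (t ^+ k) `&` U.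
(* From the k-th conjugate of [Q] on, the part in [U] lies in [V], so conjugation by [t] neither
   leaves nor enters [U] there. *)
have YnE n : conj_set Y (t ^+ n) = conj_set Q (t ^+ (k + n)) `&` U.
  elim: n => [|n IH]; first by rewrite conj_set1 addn0.
  rewrite expgSr -conj_setM IH addnS expgSr conj_setI conj_setM.
  have QnV : conj_set Q (t ^+ (k + n)) `&` U `<=` V.
    by move=> x [Qx Ux]; apply: QkV; split=> //; apply: (Qdecr k) Qx; exact: leq_addr.
  apply/seteqP; split=> x [Qx Ux]; split=> //.
    rewrite -[U](conj_setKV _ t) conj_setE.
    suff [] : V (x ^ t^-1) by [].
    by apply: QnV; split; rewrite -conj_setE ?conj_setM.
  suff [] : V x by [].
  by apply: QnV; split=> //; apply: (Qdecr _ (k + n).+1) => //; rewrite expgSr.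
have sY : is_subgroup Y by exact: (is_subgroupI (sQn k) sU).
have oY : open Y by exact: openI.
have cY : compact Y by rewrite /Y setIC; exact: compact_closedI.
have YnQ n : conj_set Y (t ^+ n) `<=` conj_set Q (t ^+ n).
  by rewrite YnE => x [Qx _]; apply: Qdecr Qx; exact: leq_addl.
have YtY : conj_set Y t `<=` Y.
  by rewrite -[t in conj_set _ t]expg1 YnE => x [Qx Ux]; split=> //;
    apply: Qdecr Qx; exact: leq_addr.
have Yincr m n : (m <= n)%N -> conj_set Y (t ^- m) `<=` conj_set Y (t ^- n).
  move=> /subnKC <-; elim: (n - m)%N => [|j IH]; first by rewrite addn0.
  apply: subset_trans IH _; rewrite addnS expgSr invgM -conj_setM.
  by apply: conj_setS => x Yx; rewrite conj_setE invgK; apply: YtY; exists x.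
have Yconj n f : Y f -> conj_set (conj_set Y (t ^+ n)) f = conj_set Y (t ^+ n).
  move=> [Qf Uf]; rewrite YnE conj_setI (is_subgroup_conj_id sU) //.
  by rewrite (is_normal_sub (nQn _)) //; exact: UR.
pose E := \bigcup_m conj_set Y (t ^- m).
have YE : Y `<=` E by move=> y Yy; exists 0%N; rewrite ?invg1 ?conj_set1.
have sE : is_subgroup E.
  split=> [|x y [m _ Yx] [n _ Yy]]; first by apply: YE; case: sY.
  exists (maxn m n) => //; have [_] := is_subgroup_conj (t ^- maxn m n) sY.
  apply; first by apply: Yincr Yx; exact: leq_maxl.
  by apply: Yincr Yy; exact: leq_maxr.
have oE : open E by apply: bigcup_open => m _; exact: open_conj.
(* An element of [E] is the conjugate by some [t ^- m] of an [f] in [Y], and [f] normalizes every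
   [conj_set Y (t ^+ n)]. *)
have nYn n : is_normal (conj_set Y (t ^+ n)) E.
  apply/is_normalE; split=> //; first exact: is_subgroup_conj.
    apply: subset_trans YE; elim: n => [|n IH]; first by rewrite conj_set1.
    rewrite expgSr -conj_setM; apply: subset_trans YtY; exact: conj_setS.
  move=> e [m _]; rewrite conj_setE invgK => Ye.
  have [f Yf ->] : exists2 f, Y f & e = t ^+ m * f / t ^+ m.
    by exists (e ^ t ^+ m) => //; rewrite mulVKg mulgK.
  rewrite -!conj_setM (conj_setM Y) -expgnDr (Yconj _ _ Yf).
  by rewrite expgnDr -conj_setM conj_setK.
have YtE m : conj_set Y (t ^- m) = conj_set (conj_set Y (t ^- m.+1)) t.
  by rewrite conj_setM expgS invgM mulgVK.
have tE : conj_set E t = E.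
  apply/seteqP; split=> x.
    rewrite conj_setE => -[[|m] _]; rewrite -conj_setE.
      by rewrite invg1 conj_set1 => Yx; apply/YE/YtY.
    by rewrite -YtE => Yx; exists m.
  by move=> [m _]; rewrite YtE conj_setE => Yx; rewrite conj_setE; exists m.+1.
apply: (@no_compact_open_normal E Y) => //; last first.
- by rewrite -[Y]conj_set1; exact: (nYn 0%N).
- by move=> x Nx; apply: Qt1 => n; apply: YnQ; apply: Nx => //; exact: open_conj.
move=> N oN nN tN; have {}tN := tN t tE.
have [_ sN NE _] := nN; apply/seteqP; split=> //.
(* By compactness [N] contains some conjugate of [Y] by a power of [t]. As [t] normalizes [N], it
   contains them all, hence [E]. *)
have [n YnN] : exists n, conj_set Y (t ^+ n) `<=` N.
  apply: contrapT => nn.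
  have cYN : compact (Y `\` N).
    by apply: compact_closedI => //; exact: open_closedC.
  have [||||d [Yd Nd] dY] :=
      compact_directed cYN (F := range (fun n => conj_set Q (t ^+ n))).
  - by exists (conj_set Q (t ^+ 0)), 0%N.
  - move=> _ _ [m _ <-] [n _ <-]; exists (conj_set Q (t ^+ maxn m n)).
      by exists (maxn m n).
    by rewrite subsetI; split; apply: Qdecr; rewrite ?leq_maxl ?leq_maxr.
  - by move=> _ [n _ <-].
  - move=> _ [n _ <-]; apply: contrapT => YNQ; apply: nn; exists n => x Yx.
    apply: contrapT => Nx; apply: YNQ; exists x; split; last exact: YnQ.
    by split=> //; move: Yx; rewrite YnE => -[Qx Ux]; split=> //;
      apply: Qdecr Qx; exact: leq_addr.
  apply: Nd; rewrite (Qt1 d) => [|n]; last by apply: dY; exists n.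
  by case: sN.
have Ntm m : conj_set N (t ^- m) = N.
  have sT := normalizer_is_subgroup N.
  exact: (is_subgroupV sT (is_subgroupX m sT tN)).
move=> x [m _ Yx]; rewrite -(Ntm m) -(Ntm n).
move: Yx; rewrite -{1}[Y](conj_setK _ (t ^+ n)).
exact: (conj_setS (conj_setS YnN)).
Qed.

(** * Windows: intersections of the conjugates of [O] by powers of [t] with exponents from [-a] to
    [b] *)

Definition conj_window (O : set G) (t : G) (a b : nat) : set G :=
  [set x | (forall n, (n <= a)%N -> conj_set O (t ^- n) x) /\
           (forall n, (n <= b)%N -> conj_set O (t ^+ n) x)].

Lemma conj_window_inv O t a b : conj_window O t^-1 a b = conj_window O t b a.
Proof.
rewrite /conj_window; apply/seteqP.
by split=> x [xa xb]; split=> n; rewrite ?expVgn ?invgK => le_n;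
  [have := xb n le_n|have := xa n le_n|have := xb n le_n|have := xa n le_n];
  rewrite ?expVgn ?invgK.
Qed.

Lemma conj_windowS O t a b a' b' : (a' <= a)%N -> (b' <= b)%N ->
  conj_window O t a b `<=` conj_window O t a' b'.
Proof.
move=> aa bb x [xa xb]; split=> n le_n; first exact/xa/(leq_trans le_n).
exact/xb/(leq_trans le_n).
Qed.

(** Conjugation by [t] adds 1 to each exponent; -1 becomes 0, which both families of the window
    contain. *)
Lemma conj_window_shift O t a b :
  conj_set (conj_window O t a.+1 b) t = conj_window O t a b.+1.
Proof.
apply/seteqP; split=> x; rewrite conj_setE => -[xa xb]; split=> n le_n.
- have := xa n.+1 le_n.
  by rewrite -conj_setE conj_setM expgS invgM mulgVK.
- case: n le_n => [_|n le_n]; last first.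
    by have := xb n le_n; rewrite -conj_setE conj_setM -expgSr.
  by have := xa 1%N isT; rewrite -conj_setE conj_setM expg1 mulVg.
- rewrite -conj_setE conj_setM; case: n le_n => [_|n le_n]; last first.
    by rewrite expgS invgM mulgVK; exact: xa.
  by have := xb 1%N isT; rewrite invg1 mul1g.
- by rewrite -conj_setE conj_setM -expgSr; exact: xb.
Qed.

Section ConjWindow.
Variable O : set G.
Hypotheses (oO : open O) (nO : is_normal O R).

Let nOg g : is_normal (conj_set O g) R. Proof. exact: is_normal_conj. Qed.
Let clOg g : closed (conj_set O g).
Proof. by apply: open_subgroup_closed; [case: (nOg g)|exact: open_conj]. Qed.

Lemma conj_windowE t a b : conj_window O t a b =
  (\bigcap_(n in [set n | (n <= a)%N]) conj_set O (t ^- n)) `&`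
  (\bigcap_(n in [set n | (n <= b)%N]) conj_set O (t ^+ n)).
Proof. by []. Qed.

Lemma conj_window_normal t a b : is_normal (conj_window O t a b) R.
Proof.
by rewrite conj_windowE; apply: is_normalI; apply: is_normal_bigcap => //; exists 0%N.
Qed.

Lemma conj_window_closed t a b : closed (conj_window O t a b).
Proof. by rewrite conj_windowE; apply: closedI; apply: closed_bigI. Qed.

Lemma conj_window_open t a b : open (conj_window O t a b).
Proof.
have oOg g : open (conj_set O g) by exact: open_conj.
elim: b => [|b IH].
  elim: a => [|a IH].
    suff -> : conj_window O t 0 0 = O by [].
    apply/seteqP; split=> x; first by move=> [/(_ 0%N isT)]; rewrite invg1 conj_set1.
    by move=> Ox; split=> n; rewrite leqn0 => /eqP ->; rewrite ?invg1 conj_set1.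
  suff -> : conj_window O t a.+1 0 = conj_window O t a 0 `&` conj_set O (t ^- a.+1).
    exact: openI.
  apply/seteqP; split=> x.
    by move=> xw; split; [exact: conj_windowS xw|case: xw => xa _; exact: xa].
  move=> [[xa xb] xa1]; split=> // n; rewrite leq_eqVlt ltnS => /orP[/eqP->|] //.
  exact: xa.
suff -> : conj_window O t a b.+1 = conj_window O t a b `&` conj_set O (t ^+ b.+1).
  exact: openI.
apply/seteqP; split=> x.
  by move=> xw; split; [exact: conj_windowS xw|case: xw => _ xb; exact: xb].
move=> [[xa xb] xb1]; split=> // n; rewrite leq_eqVlt ltnS => /orP[/eqP->|] //.
exact: xb.
Qed.

(** A nontrivial half-infinite window [Q b] would be open, and [t] conjugates it into itself, onto
    [Q b.+1]; [contracting_conj_bigcap] would then give a nontrivial element of all windows. *)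
Lemma half_window_trivg t :
  (forall x, (forall a b, conj_window O t a b x) -> x = 1) ->
  forall b x, (forall a, conj_window O t a b x) -> x = 1.
Proof.
move=> win1 b; pose Q b := \bigcap_a conj_window O t a b.
suff Q1 : Q b = [set 1] by move=> x xw; suff : Q b x by rewrite Q1.
apply: contrapT => Q1.
have nQ : is_normal (Q b) R.
  by apply: is_normal_bigcap => // a _; exact: conj_window_normal.
have oQ : open (Q b).
  apply: (normal_open sR oR _ nQ Q1).
  by apply: closed_bigI => a _; exact: conj_window_closed.
have QtS c : conj_set (Q c) t = Q c.+1.
  apply/seteqP; split=> x; rewrite conj_setE => Qx a _.
    by rewrite -conj_window_shift conj_setE; exact: Qx.
  apply: (@conj_windowS O t a.+1 c) => //.
  by rewrite -conj_setE conj_window_shift; exact: Qx.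
have Qtn n : conj_set (Q b) (t ^+ n) = Q (b + n)%N.
  elim: n => [|n IH]; first by rewrite conj_set1 addn0.
  by rewrite expgSr -conj_setM IH QtS addnS.
have [|x x1 Qx] := contracting_conj_bigcap oQ nQ (t := t).
  by rewrite QtS => x Qx a _; apply: (@conj_windowS O t a b.+1) => //; exact: Qx.
apply: x1; apply: win1 => a c; apply: (@conj_windowS O t a (b + c)) => //.
  exact: leq_addl.
by have := Qx c; rewrite Qtn; apply.
Qed.

(* Write D(a, b) for the window. If both half intersections are trivial, then some
   D(k, k) `&` U lies in U ^ t and U ^ t^-1, so that conjugation by t maps
   D(a + 1, b) `&` U onto D(a, b + 1) `&` U for a, b >= k. Were D(k + i, k) `&` U
   inside the (k + 1)-st conjugate of O for some i, these shifts would put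
   D(k, k + i) `&` U in the trivial intersection of all D(k, b). *)
Lemma conj_power_bigcap_nontrivial t :
  exists2 x, x <> 1 & forall a b, conj_window O t a b x.
Proof.
apply: contrapT => nx.
have win1 x : (forall a b, conj_window O t a b x) -> x = 1.
  by move=> xw; apply: contrapT => x1; apply: nx; exists x.
have left1 := half_window_trivg win1.
have right1 a x : (forall b, conj_window O t a b x) -> x = 1.
  move=> xw; apply: (@half_window_trivg t^-1 _ a) => [y yw|b].
    by apply: win1 => a' b'; rewrite -conj_window_inv; exact: yw.
  by rewrite conj_window_inv; exact: xw.
pose V := conj_set U t `&` conj_set U t^-1.
have oV : open V by apply: openI; exact: open_conj.
have [k DkV] : exists k, conj_window O t k k `&` U `<=` V.
  apply: contrapT => nk.
  have cUV : compact (U `\` V).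
    by apply: compact_closedI => //; exact: open_closedC.
  have [||||d [Ud Vd] dD] :=
      compact_directed cUV (F := range (fun n => conj_window O t n n)).
  - by exists (conj_window O t 0 0), 0%N.
  - move=> _ _ [m _ <-] [n _ <-]; exists (conj_window O t (maxn m n) (maxn m n)).
      by exists (maxn m n).
    by rewrite subsetI; split; apply: conj_windowS; rewrite ?leq_maxl ?leq_maxr.
  - by move=> _ [n _ <-]; exact: conj_window_closed.
  - move=> _ [n _ <-]; apply: contrapT => UVD; apply: nk; exists n => x [Dx Ux].
    by apply: contrapT => Vx; apply: UVD; exists x.
  apply: Vd; rewrite (win1 d) => [|a b].
    by split; rewrite conj_setE conj1g; case: sU.
  apply: (@conj_windowS O t (maxn a b) (maxn a b)); rewrite ?leq_maxl ?leq_maxr //.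
  by apply: dD; exists (maxn a b).
pose Y a b := conj_window O t a b `&` U.
have YV a b : (k <= a)%N -> (k <= b)%N -> Y a b `<=` V.
  by move=> ka kb x [xw Ux]; apply: DkV; split=> //; exact: conj_windowS xw.
have Yshift a b : (k <= a)%N -> (k <= b)%N -> conj_set (Y a.+1 b) t = Y a b.+1.
  move=> ka kb; rewrite /Y conj_setI conj_window_shift.
  apply/seteqP; split=> x [xw Ux]; split=> //.
    rewrite -[U](conj_setKV _ t) conj_setE.
    suff [] : V (x ^ t^-1) by [].
    apply: (YV a.+1 b) => //; first exact: leqW.
    by split; rewrite -conj_setE ?conj_window_shift.
  suff [] : V x by [].
  by apply: (YV a b.+1) => //; exact: leqW.
have Yshiftn i b : (k <= b)%N -> conj_set (Y (k + i)%N b) (t ^+ i) = Y k (b + i)%N.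
  elim: i b => [|i IH] b kb; first by rewrite conj_set1 !addn0.
  rewrite expgS -conj_setM addnS Yshift ?leq_addr // IH ?leqW //.
  by rewrite addSnnS.
have oY a b : open (Y a b) by apply: openI => //; exact: conj_window_open.
(* Such a [d] is absurd, as [left1] makes it 1. Compactness provides it unless some [Y (k + i) k]
   lies inside the conjugate of [O] by [t ^+ k.+1]. *)
have [d dw nOd] : exists2 d, forall a, conj_window O t a k d & ~ conj_set O (t ^+ k.+1) d.
  have cUO : compact (U `\` conj_set O (t ^+ k.+1)).
    by apply: compact_closedI => //; apply: open_closedC; exact: open_conj.
  have [||||d [Ud Od] dD] := compact_directed cUO
      (F := range (fun i => conj_window O t (k + i)%N k)).
  - by exists (conj_window O t (k + 0) k), 0%N.
  - move=> _ _ [m _ <-] [n _ <-]; exists (conj_window O t (k + maxn m n) k).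
      by exists (maxn m n).
    by rewrite subsetI; split; apply: conj_windowS => //;
      rewrite leq_add2l ?leq_maxl ?leq_maxr.
  - by move=> _ [n _ <-]; exact: conj_window_closed.
  - move=> _ [i _ <-]; apply: contrapT => UOD.
    have YO j : (i <= j)%N -> Y (k + j)%N k `<=` conj_set O (t ^+ k.+1).
      move=> ij x [xw Ux]; apply: contrapT => Ox; apply: UOD; exists x; split=> //.
      by apply: conj_windowS xw => //; rewrite leq_add2l.
    have YO' j : (i <= j)%N -> Y k (k + j)%N `<=` conj_set O (t ^+ (k + j).+1).
      move=> ij; rewrite -Yshiftn // -addSn expgnDr -conj_setM.
      by apply: conj_setS; exact: YO.
    (* Each step gains one exponent on the right, so the nontrivial [Y k (k + i)] lies in all
       windows with left end [k], against [right1]. *)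
    have Yb j : Y k (k + i)%N `<=` Y k (k + i + j)%N.
      elim: j => [|j IH]; first by rewrite addn0.
      move=> x /IH[xw Ux]; split=> //; split=> [|n]; first by case: xw.
      rewrite addnS leq_eqVlt ltnS => /orP[/eqP->|le_n]; last first.
        by case: xw => _; apply.
      by rewrite -addnA; apply: YO'; [exact: leq_addr|rewrite addnA].
    have [x Yx x1] : exists2 x, Y k (k + i)%N x & x <> 1.
      apply: exists_nontrivial => //; split; last by case: sU.
      by case: (conj_window_normal t k (k + i)) => _ [].
    apply: x1; apply: (right1 k) => b; apply: (@conj_windowS O t k (k + i + b)%N) => //.
      exact: leq_addl.
    by have [] := Yb b x Yx.
  exists d => // a; apply: (@conj_windowS O t (k + a)%N k) => //; first exact: leq_addl.
  by apply: dD; exists a.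
by apply: nOd; rewrite (left1 k d dw) conj_setE conj1g; case: nO => _ [].
Qed.

End ConjWindow.

(** * The invariance property carried up the polycyclic series of L / R *)

Definition invariant_below (M : set G) := forall O : set G, open O -> is_normal O R ->
  exists N, [/\ open N, is_normal N R, N `<=` O & forall m, M m -> conj_set N m = N].

(** The intersection [J] of the conjugates of [N] by all powers of [t] is nontrivial, hence open.
    Shifting windows makes it invariant under [t]; it is invariant under [M] because [t] normalizes
    [M]. *)
Lemma invariant_below_cyclic M M' t :
  is_subgroup M -> invariant_below M -> conj_set M t = M ->
  (forall S, is_subgroup S -> M `<=` S -> S t -> M' `<=` S) -> invariant_below M'.
Proof.
move=> sM invM Mt genM' O oO nO; have [N [oN nN NO NM]] := invM O oO nO.
pose J := \bigcap_a \bigcap_b conj_window N t a b.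
have nI : is_normal J R.
  by apply: is_normal_bigcap => // a _; apply: is_normal_bigcap => // b _;
    exact: conj_window_normal.
have oI : open J.
  apply: (normal_open sR oR _ nI).
    by apply: closed_bigI => a _; apply: closed_bigI => b _; exact: conj_window_closed.
  move=> I1; have [x x1 xw] := conj_power_bigcap_nontrivial oN nN t.
  apply: x1; suff : J x by rewrite I1.
  by move=> a _ b _; exact: xw.
exists J; split=> //.
  move=> x /(_ 0%N I 0%N I)[/(_ 0%N isT)].
  by rewrite invg1 conj_set1 => /NO.
have sI := normalizer_is_subgroup J.
suff MI : M' `<=` [set g | conj_set J g = J] by move=> m /MI.
apply: genM' => //=.
- move=> m Mm /=.
  have sMn := normalizer_is_subgroup M.
  have Ng g : conj_set M g = M -> conj_set (conj_set N g) m = conj_set N g.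
    move=> Mg; rewrite conj_setM -[g * m](mulgVK g) -conj_setM NM //.
    have := conj_setE M g^-1 (m ^ g^-1).
    by rewrite (is_subgroupV sMn Mg) invgK conjgKV conjgE invgK !mulgA => ->.
  apply/seteqP; split=> x; rewrite conj_setE => Ix a _ b _; have [xa xb] := Ix a I b I;
    split=> n le_n.
  + rewrite -Ng; first by rewrite conj_setE; exact: xa.
    exact: (is_subgroupV sMn (is_subgroupX n sMn Mt)).
  + rewrite -Ng; first by rewrite conj_setE; exact: xb.
    exact: (is_subgroupX n sMn Mt).
  + rewrite -conj_setE Ng; first exact: xa.
    exact: (is_subgroupV sMn (is_subgroupX n sMn Mt)).
  + rewrite -conj_setE Ng; first exact: xb.
    exact: (is_subgroupX n sMn Mt).
- apply/seteqP; split=> x; rewrite conj_setE => Ix a _ b _.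
    apply: (@conj_windowS N t a b.+1) => //.
    by rewrite -conj_window_shift conj_setE; exact: Ix.
  apply: (@conj_windowS N t a.+1 b) => //.
  by rewrite -conj_setE conj_window_shift; exact: Ix.
Qed.

(** Intersect the [L]-conjugates of [N]. Finiteness is asked of this orbit because in the
    application the finite index is that of a subgroup of the quotient L / R. *)
Lemma invariant_below_finite_index M L :
  is_subgroup L ->
  (forall N, (forall m, M m -> conj_set N m = N) ->
     finite_set [set conj_set N l | l in L]) ->
  invariant_below M -> invariant_below L.
Proof.
move=> sL finL invM O oO nO; have [N [oN nN NO NM]] := invM O oO nO.
pose C := [set conj_set N l | l in L].
have CN : C N by exists 1; [case: sL|exact: conj_set1].
exists (\bigcap_(X in C) X); split.
- rewrite -closedC setC_bigcap; apply: closed_bigcup; first exact: finL.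
  by move=> _ [l _ <-]; apply: open_closedC; exact: open_conj.
- by apply: is_normal_bigcap => // [|_ [l _ <-]]; [exists N|exact: is_normal_conj].
- by move=> x /(_ N CN)/NO.
- move=> l Ll; apply/seteqP; split=> x; rewrite conj_setE => Cx _ [h Lh <-].
    have := Cx (conj_set N (h / l)); rewrite -conj_setM conj_setE invgK conjgKV.
    by apply; exists (h / l); rewrite ?conj_setM //; exact: sL.2.
  rewrite -conj_setE conj_setM; apply: Cx; exists (h * l) => //.
  exact: (is_subgroupM sL).
Qed.

(** Climb the series through preimages in [L]: the trivial term lifts to [R], each cyclic factor
    adds one element [t], and the finite index of [P] ends the climb. *)
Lemma invariant_below_virtually_polycyclic L (nRL : is_normal R L) :
  virtually_polycyclic (quotient nRL) -> invariant_below L.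
Proof.
move=> [P [sP finP [n [A [A0 An cycA]]]]].
have [pi [piM piS piK piN]] := quotient_projection nRL.
have [sL _ RL _] := nRL.
have pi1 : pi 1 = 1 by apply: piN; case: sR.
have LV x : L x -> L x^-1 by exact: (is_subgroupV sL).
have LM x y : L x -> L y -> L (x * y) by exact: (is_subgroupM sL).
have piV x : L x -> pi x^-1 = (pi x)^-1.
  by move=> Lx; apply/esym/mulg1_eq; rewrite -piM ?mulgV //; exact: (LV).
pose lift B := [set x | L x /\ B (pi x)].
have lift_subgroup B : is_subgroup B -> is_subgroup (lift B).
  move=> sB; split; first by split; [case: sL|rewrite pi1; case: sB].
  move=> x y [Lx Bx] [Ly By]; split; first exact: sL.2.
  by rewrite piM ?piV //; [exact: sB.2|exact: (LV)].
have R_lift B : is_subgroup B -> R `<=` lift B.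
  by move=> [B1 _] r Rr; split; [exact: RL|rewrite piN].
have invA i : (i <= n)%N -> is_subgroup (A i) /\ invariant_below (lift (A i)).
  elim: i => [_|i IH lt_in].
    rewrite A0; split.
      by split=> // _ _ -> ->; rewrite /= mulgV.
    move=> O oO nO; exists O; split=> // m [Lm pim].
    apply: (is_normal_sub nO); rewrite -[m]mul1g -invg1.
    by apply: piK => //; [case: sL|rewrite pim pi1].
  have [sA invAi] := IH (ltnW lt_in).
  have [nA /cyclic_quotient_generator[c Ac genA]] := cycA i lt_in.
  have [sA' _ AA' _] := nA; split=> //.
  have [t Lt tc] := piS c.
  apply: (@invariant_below_cyclic (lift (A i)) _ t) => //; first exact: lift_subgroup.
    apply/seteqP; split=> x.
      rewrite conj_setE => -[Lxt Axt].
      have Lx : L x.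
        by rewrite -[x](conjgKV t) conjgE; apply: (LM); [exact: (LV)|exact: (LM)].
      split=> //; move: Axt; rewrite conjgE !piM ?piV ?invgK //; try exact: (LV).
        have := is_normal_sub nA Ac => {2}<- Axt; rewrite conj_setE conjgE invgK -tc.
        by [].
      by apply: (LM) => //; exact: (LV).
    move=> [Lx Ax]; rewrite conj_setE conjgE invgK; split.
      by apply: (LM) => //; apply: (LM) => //; exact: (LV).
    rewrite !piM ?piV //; [|exact: (LV)|by apply: (LM) => //; exact: (LV)].
    by move: Ax; rewrite -{1}(is_normal_sub nA Ac) conj_setE conjgE invgK tc.
  move=> S sS AS St b [Lb Ab].
  pose D := [set C | exists x, [/\ L x, S x & pi x = C]].
  have : D (pi b).
    apply: (genA D) => //; last by exists t.
      split=> [|_ _ [x [Lx Sx <-]] [y [Ly Sy <-]]].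
        by exists 1; split=> //; [case: sL|case: sS].
      exists (x / y); split; [exact: sL.2|exact: sS.2|].
      by rewrite piM ?piV //; exact: (LV).
    move=> C AC; have [x Lx xC] := piS C; exists x; split=> //.
    by apply: AS; split=> //; rewrite xC.
  move=> [x [Lx Sx /(piK x b Lx Lb) Rxb]]; rewrite -[b](mulVKg x).
  by apply: (is_subgroupM sS) => //; apply: AS; exact: R_lift.
have [_] := invA n (leqnn n); rewrite An.
apply: invariant_below_finite_index => // N PN.
(* The conjugate of [N] by [l] depends only on the left coset of [pi l^-1] modulo [P]; the union
   recovers it from that coset. *)
pose f (C : set (quotient nRL)) :=
  \bigcup_(l in [set l | L l /\ C (pi l^-1)]) conj_set N l.
apply: sub_finite_set (finite_image f finP) => _ [l Ll <-].
exists (mul (pi l^-1) @` P); first by exists (pi l^-1).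
have P1 : P 1 by case: sP.
apply/seteqP; split=> x; last first.
  by move=> Nx; exists l => //; split=> //; exists 1; rewrite ?mulg1.
move=> [k [Lk [p Pp plk]]]; suff -> : conj_set N k = conj_set N l by [].
rewrite -[l](mulgVK k) -conj_setM (PN (l / k)) //; split.
  by apply: (LM) => //; exact: (LV).
by rewrite piM //; [rewrite -plk piV // mulVKg|exact: (LV)].
Qed.

End OpenNormalSubgroup.
End LocallyNormal.

Theorem theorem1p12 (G : topGroupType)
    (G_hausdorff : hausdorff_space G)
    (G_lc : locally_compact [set: G])
    (G_td : totally_disconnected [set: G])
    (QZ_trivial : QZ G = [set 1])
    (G_hji : exists U : set G,
       [/\ is_subgroup U, compact U, open U & hereditarily_just_infinite U])
    (G_cg : compactly_generated [set: G]) :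
  let R := Res [set: G] in
  open R ->
  Res R = [set 1] ->
  [/\ (* (i) and (ii), about the same K *)
      exists K : set G,
        [/\ open_normal K R, ~ compact K,
            forall Q : set G, closed_normal Q R -> Q <> [set 1] ->
              exists g : G, conj_set K g `<=` Q
          & exists g : G, K `<` conj_set K g],
      (* (iii) *)
      (forall H : set G, is_subgroup H -> compactly_generated H -> R `<=` H ->
         open (Res_in R H : set (subspace R))),
      ~ compactly_generated R
    & (* (iv) *)
      forall (L : set G) (sL : is_subgroup L) (RL : R `<=` L),
        virtually_polycyclic (quotient (Res_normal sL RL)) ->
        (forall O : set G, open_normal O R ->
           exists2 N : set G, open_normal N L & N `<=` O) /\
        residually_discrete L].
Proof.
move=> R oR ResR1; have [U0 [sU0 cU0 oU0 hjiU0]] := G_hji.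
have sG : is_subgroup [set: G] by [].
have nRG : is_normal R [set: G] by exact: Res_normal.
have [_ sR _ _] := nRG.
have R_normal g : conj_set R g = R by exact: (is_normal_sub nRG).
have nondiscrete := not_open_trivg sU0 cU0 oU0 hjiU0.
have normal_open N E sE oE := @closed_normal_open G QZ_trivial U0 sU0 oU0 hjiU0 N E sE oE.
have resR x : (forall N, open N -> is_normal N R -> N x) -> x = 1.
  move=> Nx; suff : Res R x by rewrite ResR1.
  by move=> N /(open_normalE N oR)[]; exact: Nx.
(* Every element of [G] normalizes [R], so the invariant [N] is open and normal in [G] and contains
   [R] by the definition of [Res]. *)
have R_no_compact W : compact W -> open W -> ~ is_normal W R.
  apply: (no_compact_open_normal QZ_trivial nondiscrete normal_open) => //.
  move=> N oN nN cN; apply/seteqP; split; first by case: nN.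
  move=> x; apply; apply/(open_normalE N openT); split=> //.
  apply/is_normalE; split=> // [|g _]; [by case: nN|exact: cN].
pose U := U0 `&` R.
have sU : is_subgroup U by exact: (is_subgroupI sU0 sR).
have oU : open U by exact: openI.
have clR : closed R by exact: open_subgroup_closed.
have cU : compact U by exact: compact_closedI.
have UR : U `<=` R by exact: subIsetr.
have Res_open H : is_subgroup H -> compactly_generated H -> R `<=` H -> open (Res_in R H).
  exact: (Res_in_open normal_open sR oR R_normal R_no_compact sU cU oU UR).
split.
- have [K [oK nK Kmin]] := conj_minimum normal_open sR oR R_normal
    R_no_compact sU cU oU UR G_cg.
  exists K; split.
  + by apply/open_normalE.
  + by move=> cK; exact: R_no_compact nK.
  + move=> Q /(closed_normalE Q clR)[cQ nQ] Q1; apply: Kmin => //.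
    exact: normal_open nQ Q1.
  (* For (ii), conjugate [K] into its intersection with an open normal [N] not containing it, then
     conjugate back. *)
  have [N oN [nN KN]] : exists2 N, open N & is_normal N R /\ ~ K `<=` N.
    apply: contrapT => nN; apply: (@open_neq_trivg G nondiscrete K oK).
    apply/seteqP; split=> [x Kx|_ ->]; last by case: nK => _ [].
    apply: resR => N oN nNR; apply: contrapT => Nx; apply: nN; exists N => //.
    by split=> // /(_ x Kx).
  have [g KgKN] := Kmin (K `&` N) (openI oK oN) (is_normalI nK nN).
  exists g^-1; split=> [x Kx|KgK].
    rewrite conj_setE invgK; suff : (K `&` N) (x ^ g) by case.
    by apply: KgKN; exists x.
  apply: KN => x Kx; suff : (K `&` N) x by case.
  by apply: KgKN; rewrite conj_setE; apply: KgK; exists x.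
- by move=> H sH cgH RH; apply: open_subspaceW; exact: Res_open.
(* Taking [H = R] in (iii) would make [Res R], which is trivial, open. *)
- move=> cgR; apply: nondiscrete; rewrite -ResR1.
  suff -> : Res R = Res_in R R by exact: Res_open.
  have FE N : open_normal N R <-> [/\ open (N : set (subspace R)), is_subgroup N,
      N `<=` R & forall h, R h -> conj_set N h = N].
    split=> [[oN /is_normalE[_ sN NR cN]]|[oN sN NR cN]]; split=> //.
    exact/is_normalE.
  by rewrite /Res /Res_in; apply/seteqP; split=> x Nx N /FE; exact: Nx.
- move=> L sL RL vpL.
  have invL := invariant_below_virtually_polycyclic QZ_trivial nondiscrete
    normal_open sR oR R_normal sU cU oU UR vpL.
  have below O : open_normal O R -> exists2 N, open_normal N L & N `<=` O.
    move=> /(open_normalE O oR)[oO nO]; have [N [oN [_ sN NR _] NO NL]] := invL O oO nO.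
    exists N => //; split; first exact: open_subspaceW.
    by apply/is_normalE; split=> //; exact: subset_trans (RL).
  split=> //; apply/seteqP; split=> [x Lx|_ -> N [_ [_ [N1 _] _ _]]//].
  by rewrite -ResR1 => N /below[M oM]; apply; exact: Lx.
Qed.
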